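(* Let $H$ be a graded, connected Hopf algebra over $K$ which is both free and cofree, let $\mathfrak{g}=\mathrm{Prim}(H)$, and choose a non-degenerate, homogeneous bilinear form on the graded space $\frac{\mathfrak{g}}{\mathfrak{g}\cap H^{+2}}$. Then there exists a non-degenerate Hopf pairing $\langle -,-\rangle : H\times H\to K$ whose induced pairing on $\frac{\mathfrak{g}}{\mathfrak{g}\cap H^{+2}}$ is the chosen form. Moreover, if the chosen form on $\frac{\mathfrak{g}}{\mathfrak{g}\cap H^{+2}}$ is symmetric, the Hopf pairing on $H$ can be chosen symmetric.
   Context: $K$ is a commutative field of characteristic $\neq 2$. A graded connected Hopf algebra is a Hopf algebra $H=\bigoplus_{n\ge0}H_n$ over $K$ whose product, unit, coproduct $\Delta$ and counit $\varepsilon$ are homogeneous, with $H_0=K$ and every $H_n$ finite-dimensional. $H^+=\bigoplus_{n\ge1}H_n$ is the augmentation ideal and $H^{+2}$ is the span of all products $xy$ with $x,y\in H^+$. $\mathrm{Prim}(H)=\{x:\Delta(x)=x\otimes1+1\otimes x\}$ is the graded Lie algebra of primitive elements. $H$ is free if there is a graded subspace $V\subseteq H$ such that the canonical algebra map $T(V)\to H$ is an isomorphism; $H$ is cofree if it is isomorphic, as a graded coalgebra, to the tensor coalgebra $coT(W)$ (the space $T(W)$ with the deconcatenation coproduct) for some graded space $W$ with $W_0=0$. A bilinear form on a graded space is homogeneous if homogeneous elements of different degrees pair to $0$. A (homogeneous) Hopf pairing between graded connected Hopf algebras $H,H'$ is a bilinear form $\langle-,-\rangle:H\times H'\to K$ with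 $\langle x,1\rangle=\varepsilon(x)$, $\langle 1,x'\rangle=\varepsilon(x')$, $\langle xy,z'\rangle=\langle x\otimes y,\Delta(z')\rangle$, $\langle x,y'z'\rangle=\langle\Delta(x),y'\otimes z'\rangle$ (where $\langle a\otimes b,c\otimes d\rangle=\langle a,c\rangle\langle b,d\rangle$), and $\langle H_i,H'_j\rangle=0$ for $i\ne j$. For a Hopf pairing on $H\times H$, primitive elements are orthogonal to $H^{+2}$, so $\langle \bar x,\bar y\rangle:=\langle x,y\rangle$ ($x,y\in\mathfrak g$) gives a well-defined pairing on $\frac{\mathfrak{g}}{\mathfrak{g}\cap H^{+2}}$, called the induced pairing. *)

(* Defs.v *)
From HB Require Import structures.
From mathcomp Require Import all_boot all_order all_algebra.
Set Implicit Arguments. Unset Strict Implicit. Unset Printing Implicit Defensive.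
Import GRing.Theory.
Local Open Scope ring_scope.

Section Hopf.
Variable K : fieldType.

Definition lin_functional (V : lmodType K) (f : V -> K) :=
  forall a x y, f (a *: x + y) = a * f x + f y.

(* a formal linear combination of words (element of T(V), resp. coT(W)) is
   zero iff each homogeneous tensor degree k component vanishes in V^{(x)k},
   i.e. is killed by all products of k linear functionals. *)
Definition tensor_words_zero (V : lmodType K) (s : seq (K * seq V)) :=
  forall (k : nat) (f : nat -> V -> K), (forall i, lin_functional (f i)) ->
    \sum_(p <- s | size p.2 == k) p.1 * \prod_(i < k) f i (nth 0 p.2 i) = 0.

(* graded vector space: pi n is the projection on the degree n component *)
Definition graded_space (V : lmodType K) (pi : nat -> V -> V) :=
  [/\ forall n a x y, pi n (a *: x + y) = a *: pi n x + pi n y,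
      forall m n x, pi m (pi n x) = if m == n then pi n x else 0 &
      forall x, exists N, x = \sum_(n < N) pi n x].

Variable H : algType K.
Variable pi : nat -> H -> H.
Variable Delta : H -> seq (H * H).
Variable eps : H -> K.

Definition hom (n : nat) (x : H) := pi n x = x.

Definition in_span (s : seq H) (x : H) :=
  exists c : 'I_(size s) -> K, x = \sum_(i < size s) c i *: s`_i.

(* equality in H (x) H and H (x) H (x) H *)
Definition teq2 (s t : seq (H * H)) :=
  forall f g : H -> K, lin_functional f -> lin_functional g ->
    \sum_(p <- s) f p.1 * g p.2 = \sum_(p <- t) f p.1 * g p.2.

Definition teq3 (s t : seq (H * H * H)) :=
  forall f g h : H -> K, lin_functional f -> lin_functional g -> lin_functional h ->
    \sum_(p <- s) f p.1.1 * g p.1.2 * h p.2 =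
    \sum_(p <- t) f p.1.1 * g p.1.2 * h p.2.

Definition graded_connected_hopf :=
  [/\ graded_space pi /\
      (forall n, exists s : seq H, (forall y, y \in s -> hom n y) /\
                                   forall x, hom n x -> in_span s x),
      (hom 0 1 /\ (forall x, hom 0 x -> exists a : K, x = a *: 1)) /\
      (forall i j x y, hom i x -> hom j y -> hom (i + j) (x * y)),
      [/\ forall a x y, teq2 (Delta (a *: x + y))
                             ([seq (a *: p.1, p.2) | p <- Delta x] ++ Delta y),
          forall x, teq3 [seq ((q.1, q.2), p.2) | p <- Delta x, q <- Delta p.1]
                         [seq ((p.1, q.1), q.2) | p <- Delta x, q <- Delta p.2],
          lin_functional eps &
          forall x, \sum_(p <- Delta x) eps p.1 *: p.2 = x /\
                    \sum_(p <- Delta x) eps p.2 *: p.1 = x],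
      [/\ forall x y, teq2 (Delta (x * y))
                           [seq (p.1 * q.1, p.2 * q.2) | p <- Delta x, q <- Delta y],
          teq2 (Delta 1) [:: (1, 1)],
          forall x y, eps (x * y) = eps x * eps y &
          eps 1 = 1] /\
      (forall n x, hom n x -> forall i j, i + j != n ->
          teq2 [seq (pi i p.1, pi j p.2) | p <- Delta x] [::]) /\
      (forall n x, hom n x -> (0 < n)%N -> eps x = 0) &
      exists S : H -> H, (forall a x y, S (a *: x + y) = a *: S x + S y) /\
        forall x, \sum_(p <- Delta x) S p.1 * p.2 = eps x *: 1 /\
                  \sum_(p <- Delta x) p.1 * S p.2 = eps x *: 1].

Definition prim (x : H) := teq2 (Delta x) [:: (x, 1); (1, x)].

Definition Hplus (x : H) := pi 0 x = 0.
Definition Hplus2 (x : H) :=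
  exists s : seq (H * H), (forall p, p \in s -> Hplus p.1 /\ Hplus p.2) /\
    x = \sum_(p <- s) p.1 * p.2.

(* free: T(V) -> H is an isomorphism for some graded subspace V *)
Definition words_eval (s : seq (K * seq H)) : H :=
  \sum_(p <- s) p.1 *: \prod_(v <- p.2) v.

Definition is_free :=
  exists V : H -> Prop,
    [/\ V 0, (forall a x y, V x -> V y -> V (a *: x + y)),
        (forall n x, V x -> V (pi n x)),
        (forall x, exists s : seq (K * seq H),
            (forall p v, p \in s -> v \in p.2 -> V v) /\ x = words_eval s) &
        (forall s : seq (K * seq H),
            (forall p v, p \in s -> v \in p.2 -> V v) ->
            words_eval s = 0 -> tensor_words_zero s)].

(* cofree: isomorphic as graded coalgebra to coT(W), W graded, W_0 = 0;
   phi is the isomorphism coT(W) -> H, given on words (multilinearly). *)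
Definition is_cofree :=
  exists (W : lmodType K) (piW : nat -> W -> W) (phi : seq W -> H),
    [/\ graded_space piW /\ (forall w, piW 0 w = 0),
        (forall u v a w w', phi (u ++ (a *: w + w') :: v) =
                            a *: phi (u ++ w :: v) + phi (u ++ w' :: v)),
        (forall (w : seq W) (ds : seq nat), size ds = size w ->
            (forall i, (i < size w)%N -> piW (nth 0 ds i) (nth 0 w i) = nth 0 w i) ->
            hom (sumn ds) (phi w)),
        (forall x, exists s : seq (K * seq W), x = \sum_(p <- s) p.1 *: phi p.2) /\
        (forall s : seq (K * seq W), \sum_(p <- s) p.1 *: phi p.2 = 0 ->
            tensor_words_zero s) &
        (forall w, teq2 (Delta (phi w))
                        [seq (phi (take j w), phi (drop j w)) | j <- iota 0 (size w).+1]) /\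
        (forall w, eps (phi w) = if w is [::] then 1 else 0)].

(* homogeneous non-degenerate bilinear form on g / (g cap H^{+2}),
   represented by a function B on H, considered only on primitives *)
Definition quot_form (B : H -> H -> K) :=
  [/\ forall a x y z, prim x -> prim y -> prim z ->
        B (a *: x + y) z = a * B x z + B y z /\
        B z (a *: x + y) = a * B z x + B z y,
      forall x y, prim x -> prim y -> Hplus2 x -> B x y = 0 /\ B y x = 0,
      forall i j x y, prim x -> prim y -> hom i x -> hom j y -> i != j -> B x y = 0 &
      (forall x, prim x -> (forall y, prim y -> B x y = 0) -> Hplus2 x) /\
      (forall y, prim y -> (forall x, prim x -> B x y = 0) -> Hplus2 y)].

Definition bilinear_form (P : H -> H -> K) :=
  forall a x y z, P (a *: x + y) z = a * P x z + P y z /\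
                  P z (a *: x + y) = a * P z x + P z y.

Definition hopf_pairing (P : H -> H -> K) :=
  [/\ bilinear_form P,
      forall x, P x 1 = eps x /\ P 1 x = eps x,
      forall x y z, P (x * y) z = \sum_(p <- Delta z) P x p.1 * P y p.2,
      forall x y z, P x (y * z) = \sum_(p <- Delta x) P p.1 y * P p.2 z &
      forall i j x y, hom i x -> hom j y -> i != j -> P x y = 0].

Definition nondeg_pairing (P : H -> H -> K) :=
  (forall x, (forall y, P x y = 0) -> x = 0) /\
  (forall y, (forall x, P x y = 0) -> y = 0).

End Hopf.

(* Main.v *)
Require Import Defs.
From HB Require Import structures.
From mathcomp Require Import all_boot all_order all_algebra boolp.
Set Implicit Arguments. Unset Strict Implicit. Unset Printing Implicit Defensive.
(* [Defs] is imported again so that [hom] means [Defs.hom], not [vector.hom]. *)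
Import GRing.Theory Defs.
Local Open Scope ring_scope.

(** A Hopf pairing is built degree by degree. If it is known below degree [n],
    multiplicativity forces its values on [H^{+2} x H] and [H x H^{+2}] in
    degree [n]; freeness makes this well defined, coassociativity and
    [Delta (x y) = Delta x Delta y] make it consistent, and the values on a
    complement of [H^{+2}] are free. The complement is chosen to contain a
    complement of [g cap H^{+2}] in [g], where the values are those of [B]; a
    symmetric [B] then gives a symmetric pairing.

    Non-degeneracy needs no further choice. If [x] of degree [n] is orthogonal
    to [H] and the pairing is non-degenerate below [n], then [x] is primitive,
    hence lies in [H^{+2}] because [B] is non-degenerate, so
    [x = sum_k sum_i v_{k,i} x_{k,i}] with the [v_{k,i}] generators of degree
    [k < n]. Pairing [x] with the concatenation [w y] in [coT(W) = H], for [w] a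
    letter of degree [k] and [k] the largest degree occurring, leaves only
    [sum_i <v_{k,i}, w> <x_{k,i}, y>]. The letters are exactly the primitive
    elements, and no non-zero generator is orthogonal to all primitive elements
    of its degree, so the degree [k] part vanishes. *)

(** * Functionals and tensors *)

Section Linear.
Variables (K : fieldType) (U : lmodType K).
Implicit Types (f g : U -> K) (x y : U).

Lemma lf0 f : lin_functional f -> f 0 = 0.
Proof. by move=> lf; have := lf (-1) 0 0; rewrite scaler0 addr0 mulN1r addNr. Qed.

Lemma lfZ f : lin_functional f -> forall a x, f (a *: x) = a * f x.
Proof. by move=> lf a x; rewrite -[a *: x]addr0 lf lf0 // addr0. Qed.

Lemma lfD f : lin_functional f -> forall x y, f (x + y) = f x + f y.
Proof. by move=> lf x y; rewrite -[x]scale1r lf mul1r scale1r. Qed.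

Lemma lfB f : lin_functional f -> forall x y, f (x - y) = f x - f y.
Proof. by move=> lf x y; rewrite lfD // -scaleN1r lfZ // mulN1r. Qed.

Lemma lf_sum f : lin_functional f -> forall I (r : seq I) (Q : pred I) (F : I -> U),
  f (\sum_(i <- r | Q i) F i) = \sum_(i <- r | Q i) f (F i).
Proof. by move=> lf I r Q F; apply: (big_morph f (lfD lf) (lf0 lf)). Qed.

Lemma lf_null : lin_functional (fun _ : U => 0 : K).
Proof. by move=> a x y; rewrite mulr0 addr0. Qed.

Lemma lf_bigsum I (r : seq I) (Q : pred I) (F : I -> U -> K) :
  (forall i, lin_functional (F i)) -> lin_functional (fun x => \sum_(i <- r | Q i) F i x).
Proof.
move=> lF a x y; rewrite mulr_sumr -big_split /=.
by apply: eq_bigr => i _; apply: lF.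
Qed.

Lemma lf_scale c f : lin_functional f -> lin_functional (fun x => c * f x).
Proof. by move=> lf a x y; rewrite lf mulrDr mulrCA. Qed.

Lemma lf_scaler c f : lin_functional f -> lin_functional (fun x => f x * c).
Proof. by move=> lf a x y; rewrite lf mulrDl mulrA. Qed.

Section LinearMap.
Variables (V : lmodType K) (h : U -> V).
Hypothesis lh : linear h.

Lemma lm0 : h 0 = 0.
Proof. by have := lh (-1) 0 0; rewrite scaler0 addr0 scaleN1r addNr. Qed.

Lemma lmZ a x : h (a *: x) = a *: h x.
Proof. by rewrite -[a *: x]addr0 lh lm0 addr0. Qed.

Lemma lmD x y : h (x + y) = h x + h y.
Proof. by rewrite -[x]scale1r lh !scale1r. Qed.

Lemma lmB x y : h (x - y) = h x - h y.
Proof. by rewrite lmD -scaleN1r lmZ scaleN1r. Qed.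

Lemma lm_sum I (r : seq I) (Q : pred I) (F : I -> U) :
  h (\sum_(i <- r | Q i) F i) = \sum_(i <- r | Q i) h (F i).
Proof. exact: (big_morph h lmD lm0). Qed.

Lemma lf_comp (f : V -> K) : lin_functional f -> lin_functional (fun x => f (h x)).
Proof. by move=> lf a x y; rewrite lh lf. Qed.
End LinearMap.

(* Replaces a basis of the span of [ws]: vectors are only compared through
   functionals, so no functional has to be extended to [U] and no choice of a
   basis is needed. *)
Lemma dual_system (ws : seq U) :
  exists h : nat -> U -> K, (forall i, lin_functional (h i)) /\
    forall w g, w \in ws -> lin_functional g ->
      g w = \sum_(i < size ws) h i w * g ws`_i.
Proof.
elim: ws => [|w ws [h [lh sh]]].
  by exists (fun _ _ => 0); split=> // _; apply: lf_null.
pose rem x := x - \sum_(i < size ws) h i x *: ws`_i.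
have lrem : linear rem.
  move=> a x y; rewrite /rem scalerBr scaler_sumr addrACA -opprD -big_split /=.
  congr (_ - _); apply: eq_bigr => i _.
  by rewrite lh scalerDl scalerA.
have remE g x : lin_functional g ->
    g (rem x) = g x - \sum_(i < size ws) h i x * g ws`_i.
  move=> lg; rewrite lfB // lf_sum //; congr (_ - _).
  by apply: eq_bigr => i _; rewrite lfZ.
have rem_ws g w' : lin_functional g -> w' \in ws -> g (rem w') = 0.
  by move=> lg wsw'; rewrite remE // -sh // subrr.
case: (pselect (forall g, lin_functional g -> g (rem w) = 0)) => [z0|].
  exists (fun i => if i is j.+1 then h j else fun _ => 0); split=> [[|i]|w' g] //.
    exact: lf_null.
  rewrite inE big_ord_recl /= mul0r add0r => /orP[/eqP ->|wsw'] lg; last exact: sh.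
  by have /eqP := z0 g lg; rewrite remE // subr_eq0 => /eqP.
move=> /existsNP[l /not_implyP[ll /eqP l_n0]].
pose f x := l (rem x) / l (rem w).
have lf : lin_functional f by apply: lf_scaler; apply: lf_comp.
have fw : f w = 1 by rewrite /f divff.
exists (fun i => if i is j.+1 then fun x => h j (x - f x *: w) else f).
split=> [[|i] //|w' g].
  move=> a x y; rewrite -lh; congr (h i _); rewrite lf scalerDl -scalerA scalerBr.
  by rewrite opprD addrACA.
rewrite inE big_ord_recl /= => /orP[/eqP ->|wsw'] lg.
  rewrite fw mul1r scale1r subrr big1 ?addr0 // => i _.
  by rewrite lf0 // mul0r.
have -> : f w' = 0 by rewrite /f rem_ws // mul0r.
by rewrite mul0r add0r scale0r subr0; apply: sh.
Qed.

(** The hypothesis only tests products of functionals; expanding the second factors in a dual system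
    turns [b] into a sum of such products. *)
Lemma sum_dual2 (s : seq (U * U)) (b : U -> U -> K) :
  (forall x, lin_functional (b x)) -> (forall y, lin_functional (b^~ y)) ->
  (forall f g, lin_functional f -> lin_functional g ->
     \sum_(p <- s) f p.1 * g p.2 = 0) ->
  \sum_(p <- s) b p.1 p.2 = 0.
Proof.
move=> lb rb s0.
have [h [lh sh]] := dual_system (map snd s).
rewrite (eq_big_seq (fun p => \sum_(i < size (map snd s)) h i p.2 * b p.1 (map snd s)`_i)).
  rewrite exchange_big /= big1 // => i _.
  rewrite -[RHS](s0 (b^~ (map snd s)`_i) (h i)) //.
  by apply: eq_bigr => p _; rewrite mulrC.
by move=> p sp; apply: sh (lb _); apply: map_f.
Qed.

(** These are the linear maps out of the tensor algebra, given on words. *)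
Definition multilinear_words (V : lmodType K) (M : seq U -> V) :=
  forall u v a w w', M (u ++ (a *: w + w') :: v) =
    a *: M (u ++ w :: v) + M (u ++ w' :: v).

(** Expanding every letter in a dual system of all letters that occur writes [M], on words of length
    [k], as a combination of products of [k] functionals. *)
Lemma tensor_words_zero_multilinear_size (s : seq (K * seq U)) (M : seq U -> K^o) k :
  multilinear_words M -> tensor_words_zero s ->
  \sum_(p <- s | size p.2 == k) p.1 * M p.2 = 0.
Proof.
move=> mM s0.
set ws := flatten (map snd s).
have [h [lh sh]] := dual_system ws.
pose ok (w : seq U) := forall x, x \in w -> x \in ws.
have oks p : p \in s -> ok p.2.
  move=> sp x px; apply/flattenP; exists p.2 => //.
  exact: map_f.
(* [words j] lists the words of length [j] in the indices of [ws]. *)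
pose fix words j := if j is j'.+1 then
   [seq i :: J | i <- iota 0 (size ws), J <- words j'] else [:: [::]].
have expand w u : ok w ->
  M (u ++ w) = \sum_(J <- words (size w))
    (\prod_(i < size w) h (nth 0%N J i) (nth 0 w i)) * M (u ++ [seq ws`_j | j <- J]).
  elim: w u => [|x w IH] u okw.
    by rewrite /= big_seq1 big_ord0 mul1r cats0.
  have lx : lin_functional (fun x => M (u ++ x :: w)) by move=> a y y'; apply: mM.
  rewrite [LHS](sh x _ (okw x (mem_head _ _)) lx) /= big_allpairs_dep /=.
  rewrite -[X in iota 0 X]subn0 big_mkord.
  apply: eq_bigr => i _; rewrite -cat_rcons IH; last first.
    by move=> y wy; apply: okw; rewrite inE wy orbT.
  rewrite mulr_sumr; apply: eq_bigr => J _.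
  by rewrite big_ord_recl /= mulrA cat_rcons.
rewrite big_mkcond /= (eq_big_seq (fun p => \sum_(J <- words k)
    (if size p.2 == k then p.1 * \prod_(i < k) h (nth 0%N J i) (nth 0 p.2 i)
     else 0) * M [seq ws`_j | j <- J])).
  rewrite exchange_big /= big1 // => J _.
  by rewrite -mulr_suml -big_mkcond /= (s0 k (fun i => h (nth 0%N J i))) ?mul0r.
move=> p sp; case: eqP => [<-|_]; last by rewrite big1 // => J _; rewrite mul0r.
rewrite -[p.2 in LHS]cat0s expand; last exact: oks.
by rewrite mulr_sumr; apply: eq_bigr => J _; rewrite mulrA.
Qed.

Lemma tensor_words_zero_multilinear (s : seq (K * seq U)) (M : seq U -> K^o) :
  multilinear_words M -> tensor_words_zero s -> \sum_(p <- s) p.1 * M p.2 = 0.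
Proof.
move=> mM s0.
have [N ltN] : exists N, forall p, p \in s -> (size p.2 < N)%N.
  elim: (s) => [|p s' [N HN]]; first by exists 0%N.
  exists (maxn (size p.2).+1 N) => q; rewrite inE leq_max => /orP[/eqP ->|/HN ->].
    by rewrite leqnn.
  by rewrite orbT.
transitivity (\sum_(k < N) \sum_(p <- s | size p.2 == k) p.1 * M p.2).
  under [RHS]eq_bigr do rewrite big_mkcond /=.
  rewrite exchange_big /= [in LHS]big_seq [RHS]big_seq.
  apply: eq_bigr => p /ltN ltp.
  rewrite (bigD1 (Ordinal ltp)) //= eqxx big1 ?addr0 // => i ne.
  by case: eqP => // e; case/eqP: ne; apply: val_inj.
by apply: big1 => k _; apply: tensor_words_zero_multilinear_size.
Qed.
End Linear.

(** * Subspaces and coordinates in finite dimension *)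

Lemma subspace_rowspace (K : fieldType) d (U : 'rV[K]_d -> Prop) :
  U 0 -> (forall a x y, U x -> U y -> U (a *: x + y)) ->
  exists A : 'M[K]_d, forall v, U v <-> (v <= A)%MS.
Proof.
move=> U0 Ulin.
(* Induction on a bound [k] for the codimension: a vector of [U] outside the row space of [A] is
   added to [A]. *)
suff main k (A : 'M[K]_d) : (d - \rank A <= k)%N -> (forall v, (v <= A)%MS -> U v) ->
    exists A : 'M[K]_d, forall v, U v <-> (v <= A)%MS.
  apply: (main d 0); first by rewrite leq_subr.
  by move=> v; rewrite submx0 => /eqP ->.
elim: k A => [|k IH] A leA sA; case: (pselect (forall v, U v -> (v <= A)%MS)) => [UA|].
- by exists A => v; split; [apply: UA | apply: sA].
- move=> /existsNP[v /not_implyP[_ []]].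
  apply: submx_full; rewrite /row_full eqn_leq rank_leq_row /=.
  by rewrite -subn_eq0 -leqn0.
- by exists A => v; split; [apply: UA | apply: sA].
move=> /existsNP[v /not_implyP[Uv /negP nAv]].
apply: (IH (A + v)%MS) => [|w].
  have ltA : (\rank A < \rank (A + v)%MS)%N.
    apply: rank_ltmx; rewrite ltmxE addsmxSl /=.
    by apply: contra nAv => /(submx_trans (addsmxSr A v)).
  have leq_d := rank_leq_row A; have := leA.
  by rewrite !leq_subLR addnS -addSn => /leq_trans; apply; rewrite leq_add2r.
case/sub_addsmxP=> -[u1 u2] /= ->; rewrite addrC [u2]mx11_scalar mul_scalar_mx.
by apply: Ulin => //; apply: sA; apply: submxMl.
Qed.

(** The coordinates of an element are its coefficients over [s], taken modulo the linear relations
    in [s]. *)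
Lemma finite_coordinates (K : fieldType) (U : algType K) (pr : U -> U) (s : seq U) :
  linear pr -> (forall y, y \in s -> pr y = y) -> (forall x, in_span s (pr x)) ->
  exists d (c : U -> 'rV[K]_d) (t : 'rV[K]_d -> U),
    [/\ linear c, linear t, forall y, pr (t y) = t y, forall y, c (t y) = y &
        forall x, t (c x) = pr x].
Proof.
move=> lpr prs sp; pose m := size s.
pose ev (a : 'rV[K]_m) := \sum_(i < m) a 0 i *: s`_i.
have lev : linear ev.
  move=> k x y; rewrite /ev scaler_sumr -big_split; apply: eq_bigr => i _.
  by rewrite !mxE scalerDl scalerA.
have prev a : pr (ev a) = ev a.
  rewrite (lm_sum lpr); apply: eq_bigr => i _; rewrite (lmZ lpr) prs //.
  by rewrite mem_nth.
(* The row space of [R] consists of the linear relations between the members of [s]. *)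
have [|k x y x0 y0|R RP] := @subspace_rowspace K m (fun a => ev a = 0).
- exact: lm0.
- by rewrite lev x0 y0 scaler0 addr0.
have [x|a_ evK] := @choice U 'rV[K]_m (fun x a => ev a = pr x).
  have [c ->] := sp x.
  by exists (\row_i c i); apply: eq_bigr => i _; rewrite mxE.
(* [C] has full column rank and its left kernel is the row space of [R]: [a *m C] gives coordinates
   modulo the relations, and [pinvmx C] a section. *)
set C := col_base (cokermx R).
have evC a b : ev a = ev b <-> a *m C = b *m C.
  have -> : ev a = ev b <-> (a - b <= R)%MS.
    rewrite -RP (lmB lev); split=> [->|/eqP]; first by rewrite subrr.
    by rewrite subr_eq0 => /eqP.
  rewrite submxE -[X in _ *m X == _]mulmx_base mulmxA.
  rewrite mulmx_free_eq0 ?row_base_free // mulmxBl subr_eq0.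
  by split=> /eqP.
have CK y : y *m pinvmx C *m C = y.
  by apply: mulmxKpV; apply: submx_full; apply: col_base_full.
exists (\rank (cokermx R)), (fun x => a_ x *m C), (fun y => ev (y *m pinvmx C)); split.
- move=> k x y; rewrite scalemxAl -mulmxDl; apply/evC.
  by rewrite lev !evK lpr.
- by move=> k x y; rewrite mulmxDl -scalemxAl lev.
- by move=> y; rewrite prev.
- by move=> y; rewrite -[RHS]CK; apply/evC; rewrite evK prev.
- by move=> x; rewrite -evK; apply/evC; rewrite CK.
Qed.

(** * Graded connected Hopf algebras *)

Section HopfBasics.
Variables (K : fieldType) (H : algType K) (pi : nat -> H -> H).
Variables (Delta : H -> seq (H * H)) (eps : H -> K).
Hypothesis HH : graded_connected_hopf pi Delta eps.
Implicit Types (f g h : H -> K) (x y z : H).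

Lemma lpi n : linear (pi n).
Proof. by case: HH => -[[lp _ _] _] _ _ _ _ a x y; apply: lp. Qed.

Lemma pi_pi m n x : pi m (pi n x) = if m == n then pi n x else 0.
Proof. by case: HH => -[[_ pp _] _] *. Qed.

Lemma hom_pi n x : hom pi n (pi n x).
Proof. by rewrite /hom pi_pi eqxx. Qed.

Lemma pi_hom m n x : hom pi n x -> m != n -> pi m x = 0.
Proof. by move=> <- /negbTE ne; rewrite pi_pi ne. Qed.

Lemma homZ n a x : hom pi n x -> hom pi n (a *: x).
Proof. by rewrite /hom (lmZ (lpi n)) => ->. Qed.

Lemma hom_sum n I (r : seq I) (Q : pred I) (F : I -> H) :
  (forall i, Q i -> hom pi n (F i)) -> hom pi n (\sum_(i <- r | Q i) F i).
Proof. by move=> hF; rewrite /hom (lm_sum (lpi n)); apply: eq_bigr => i /hF. Qed.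

Lemma pi_bound x : exists N, forall k, (N <= k)%N -> pi k x = 0.
Proof.
case: HH => -[[_ _ /(_ x)[N xE]] _] _ _ _ _; exists N => k leNk.
rewrite xE (lm_sum (lpi k)) big1 // => i _; rewrite pi_pi.
by case: eqP => // e; move: (ltn_ord i); rewrite -e ltnNge leNk.
Qed.

Lemma pi_bound_seq (xs : seq H) :
  exists N, forall x, x \in xs -> forall k, (N <= k)%N -> pi k x = 0.
Proof.
elim: xs => [|x xs [N HN]]; first by exists 0%N.
have [M HM] := pi_bound x; exists (maxn M N) => y; rewrite inE => /orP[/eqP ->|xsy] k.
  by rewrite geq_max => /andP[? _]; apply: HM.
by rewrite geq_max => /andP[_ ?]; apply: HN.
Qed.

Lemma sum_pi N x : (forall k, (N <= k)%N -> pi k x = 0) -> x = \sum_(k < N) pi k x.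
Proof.
move=> xN; case: HH => -[[_ _ /(_ x)[M xE]] _] _ _ _ _; rewrite {1}xE.
have [leNM|/ltnW leMN] := leqP N M.
  rewrite -(subnKC leNM) big_split_ord /= [X in _ + X]big1 ?addr0 // => i _.
  by rewrite xN // leq_addr.
rewrite -(subnKC leMN) [RHS]big_split_ord /= [X in _ = _ + X]big1 ?addr0 // => i _.
rewrite xE (lm_sum (lpi _)) big1 // => j _; rewrite pi_pi.
by case: eqP => // e; move: (ltn_ord j); rewrite -e ltnNge leq_addr.
Qed.

Lemma pi_ext x y : (forall n, pi n x = pi n y) -> x = y.
Proof.
move=> e; have [N xN] := pi_bound_seq [:: x; y].
rewrite (sum_pi (xN x _)) ?mem_head // (sum_pi (xN y _)) ?inE ?eqxx ?orbT //.
by apply: eq_bigr => i _; apply: e.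
Qed.

Lemma graded_ind (Q : H -> Prop) :
  (forall x y, Q x -> Q y -> Q (x + y)) -> (forall n x, hom pi n x -> Q x) ->
  forall x, Q x.
Proof.
move=> QD Qh x; have [N xN] := pi_bound x; rewrite (sum_pi xN).
apply: (big_ind Q) => // [|i _]; last exact/Qh/hom_pi.
by apply: (Qh 0%N); rewrite /hom (lm0 (lpi 0)).
Qed.

Lemma homM i j x y : hom pi i x -> hom pi j y -> hom pi (i + j)%N (x * y).
Proof. by case: HH => _ [_ hM] _ _ _; apply: hM. Qed.

Lemma hom1 : hom pi 0 1.
Proof. by case: HH => _ [[]]. Qed.

Lemma leps : lin_functional eps.
Proof. by case: HH => _ _ []. Qed.

Lemma eps1 : eps 1 = 1.
Proof. by case: HH => _ _ _ [[]]. Qed.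

Lemma eps_hom n x : hom pi n x -> (0 < n)%N -> eps x = 0.
Proof. by case: HH => _ _ _ [_ [_ eh]] _; apply: eh. Qed.

Lemma hom0E x : hom pi 0 x -> x = eps x *: 1.
Proof.
case: HH => _ [[_ h0] _] _ _ _ /h0[a ->].
by rewrite (lfZ leps) eps1 mulr1.
Qed.

Lemma pi0E x : pi 0 x = eps x *: 1.
Proof.
rewrite [LHS]hom0E; last exact: hom_pi.
congr (_ *: _); elim/graded_ind: x => [x y IHx IHy|n x hx].
  by rewrite (lmD (lpi 0)) !(lfD leps) IHx IHy.
case: n hx => [->//|n hx]; rewrite (pi_hom hx) // (eps_hom hx) //.
exact: (lf0 leps).
Qed.

Lemma HplusE x : Hplus pi x <-> eps x = 0.
Proof.
rewrite /Hplus pi0E; split=> [|->]; last by rewrite scale0r.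
by move/(congr1 eps); rewrite (lfZ leps) eps1 mulr1 (lf0 leps).
Qed.

Lemma Hplus_hom n x : hom pi n x -> (0 < n)%N -> Hplus pi x.
Proof. by move=> hx n0; apply/HplusE; apply: eps_hom hx n0. Qed.

Lemma hom_coordinates n : exists d (c : H -> 'rV[K]_d) (t : 'rV[K]_d -> H),
    [/\ linear c, linear t, forall w, hom pi n (t w), forall w, c (t w) = w &
        forall x, t (c x) = pi n x].
Proof.
case: HH => -[_ /(_ n)[s [hs sp]]] _ _ _ _.
by apply: finite_coordinates (lpi n) hs _ => x; apply/sp/hom_pi.
Qed.

(** Coordinates on the finite-dimensional components already supply enough functionals. *)
Lemma functionals_separate x : (forall f, lin_functional f -> f x = 0) -> x = 0.
Proof.
move=> x0; have [N xN] := pi_bound x; rewrite (sum_pi xN) big1 // => n _.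
have [d [c [t [lc lt ht ct tc]]]] := hom_coordinates n.
rewrite -tc (_ : c x = 0) ?(lm0 lt) //; apply/rowP => j; rewrite mxE.
by apply: (x0 (fun x => c x 0 j)) => a y z; rewrite lc !mxE.
Qed.

Lemma functionals_separate_eq x y :
  (forall f, lin_functional f -> f x = f y) -> x = y.
Proof.
move=> xy; apply/eqP; rewrite -subr_eq0; apply/eqP/functionals_separate => f lf.
by rewrite lfB // xy // subrr.
Qed.

(** Multiplication factors through the tensor product, where [s] is zero. *)
Lemma teq2_null_mul (s : seq (H * H)) : teq2 s [::] -> \sum_(p <- s) p.1 * p.2 = 0.
Proof.
move=> s0; apply: functionals_separate => l ll; rewrite lf_sum //.
apply: (sum_dual2 (b := fun x y => l (x * y))) => [x a y z|y a x z|f g lf lg].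
- by rewrite mulrDr -scalerAr ll.
- by rewrite mulrDl -scalerAl ll.
- by rewrite s0 // big_nil.
Qed.

(** The product of the algebra dual to [H]. Equality of tensors is tested by functionals, so the
    coalgebra axioms are used as the laws of this product. *)
Definition convolution f g x := \sum_(p <- Delta x) f p.1 * g p.2.
Local Notation conv := convolution.

Lemma lconv f g : lin_functional f -> lin_functional g -> lin_functional (conv f g).
Proof.
move=> lf lg a x y; case: HH => _ _ [lD _ _ _] _ _; rewrite /conv lD // big_cat big_map /=.
by rewrite mulr_sumr; congr (_ + _); apply: eq_bigr => p _; rewrite lfZ // mulrA.
Qed.

Lemma eq_conv f f' g g' : f =1 f' -> g =1 g' -> conv f g =1 conv f' g'.
Proof. by move=> ef eg x; apply: eq_bigr => p _; rewrite ef eg. Qed.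

Lemma convA f g h x : lin_functional f -> lin_functional g -> lin_functional h ->
  conv (conv f g) h x = conv f (conv g h) x.
Proof.
move=> lf lg lh; case: HH => _ _ [_ coA _ _] _ _.
have := coA x f g h lf lg lh; rewrite !big_allpairs_dep /= => e.
rewrite /conv; under eq_bigr do rewrite mulr_suml.
rewrite e; apply: eq_bigr => p _; rewrite mulr_sumr.
by apply: eq_bigr => q _; rewrite mulrA.
Qed.

Lemma conv_epsl g x : lin_functional g -> conv eps g x = g x.
Proof.
move=> lg; case: HH => _ _ [_ _ _ /(_ x)[xE _]] _ _; rewrite -[in RHS]xE lf_sum //.
by apply: eq_bigr => p _; rewrite lfZ.
Qed.

Lemma conv_epsr f x : lin_functional f -> conv f eps x = f x.
Proof.
move=> lf; case: HH => _ _ [_ _ _ /(_ x)[_ xE]] _ _; rewrite -[in RHS]xE lf_sum //.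
by apply: eq_bigr => p _; rewrite lfZ // mulrC.
Qed.

Lemma convM f g x y : lin_functional f -> lin_functional g ->
  conv f g (x * y) =
    \sum_(p <- Delta x) \sum_(q <- Delta y) f (p.1 * q.1) * g (p.2 * q.2).
Proof.
move=> lf lg; case: HH => _ _ _ [[DM _ _ _] _] _.
by rewrite /conv DM // big_allpairs_dep.
Qed.

Lemma conv1 f g : lin_functional f -> lin_functional g -> conv f g 1 = f 1 * g 1.
Proof.
by move=> lf lg; case: HH => _ _ _ [[_ D1 _ _] _] _; rewrite /conv D1 // big_seq1.
Qed.

Lemma conv_prim f g x : lin_functional f -> lin_functional g -> prim Delta x ->
  conv f g x = f x * g 1 + f 1 * g x.
Proof. by move=> lf lg px; rewrite /conv px // big_cons big_seq1. Qed.

Lemma conv_hom0 n f g i j x : lin_functional f -> lin_functional g ->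
  hom pi n x -> (i + j)%N != n -> conv (fun a => f (pi i a)) (fun b => g (pi j b)) x = 0.
Proof.
move=> lf lg hx ne; case: HH => _ _ _ [_ [hD _]] _.
by have := hD n x hx i j ne f g lf lg; rewrite big_map big_nil.
Qed.

Lemma lf_pi f n : lin_functional f -> lin_functional (fun x => f (pi n x)).
Proof. by move=> lf; apply: lf_comp lf; apply: lpi. Qed.

Lemma conv_homE n f g x : lin_functional f -> lin_functional g -> hom pi n x ->
  conv f g x =
    \sum_(i < n.+1) conv (fun a => f (pi i a)) (fun b => g (pi (n - i) b)) x.
Proof.
move=> lf lg hx.
have [N bN] := pi_bound_seq (map fst (Delta x) ++ map snd (Delta x)).
pose M := maxn N n.+1.
have bM z : z \in map fst (Delta x) ++ map snd (Delta x) -> z = \sum_(k < M) pi k z.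
  move=> zin; apply: sum_pi => k leMk; apply: bN => //.
  by apply: leq_trans leMk; rewrite leq_maxl.
(* The convolution is split over all bidegrees below [M]; those of total degree other than [n] then
   drop out. *)
transitivity (\sum_(i < M) \sum_(j < M)
   conv (fun a => f (pi i a)) (fun b => g (pi j b)) x).
  rewrite /conv; under [RHS]eq_bigr do rewrite exchange_big /=.
  rewrite exchange_big /=; apply: eq_big_seq => p xp.
  have -> : f p.1 = \sum_(i < M) f (pi i p.1).
    by rewrite [p.1 in LHS]bM ?lf_sum // mem_cat (map_f fst).
  have -> : g p.2 = \sum_(i < M) g (pi i p.2).
    by rewrite [p.2 in LHS]bM ?lf_sum // mem_cat (map_f snd) ?orbT.
  by rewrite big_distrlr.
have leM : (n < M)%N by rewrite leq_max leqnn orbT.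
rewrite -(subnKC leM) big_split_ord /= [X in _ + X]big1 ?addr0; last first.
  move=> i _; rewrite big1 // => j _; apply: conv_hom0 (hx) _ => //.
  by rewrite gtn_eqF // -addnA addSn ltnS leq_addr.
apply: eq_bigr => i _.
have leN : (n - i < n.+1 + (M - n.+1))%N.
  by rewrite subnKC //; apply: leq_ltn_trans leM; apply: leq_subr.
rewrite (bigD1 (Ordinal leN)) //= [X in _ + X]big1 ?addr0 // => j ne.
apply: conv_hom0 (hx) _ => //; apply: contra ne => /eqP e.
by apply/eqP/val_inj; rewrite /= -[X in (X - i)%N]e addKn.
Qed.

(** Carries an identity on bidegrees of total degree [n] through a convolution; inductions on the
    degree enter this way. *)
Lemma eq_conv_hom n f f' g g' x :
  lin_functional f -> lin_functional g -> lin_functional f' -> lin_functional g' ->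
  hom pi n x ->
  (forall i j a b, (i + j)%N = n -> hom pi i a -> hom pi j b -> f a * g b = f' a * g' b) ->
  conv f g x = conv f' g' x.
Proof.
move=> lf lg lf' lg' hx e; rewrite !(conv_homE (n := n)) //.
apply: eq_bigr => i _; apply: eq_bigr => p _.
by apply: (e i (n - i)%N); rewrite ?subnKC ?leq_ord //; apply: hom_pi.
Qed.

(** * Primitive elements and gradings *)

Lemma prim_eps x : prim Delta x -> eps x = 0.
Proof.
(* Since [eps] is idempotent for convolution, [eps x = eps x + eps x]. *)
move=> px; have := conv_prim leps leps px.
rewrite conv_epsl; last exact: leps.
by rewrite eps1 mulr1 mul1r => /(congr1 (fun t => t - eps x)); rewrite subrr addrK.
Qed.

Lemma prim_pi n x : prim Delta x -> prim Delta (pi n x).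
Proof.
move=> px f g lf lg; rewrite big_cons big_seq1 /= -/(conv f g (pi n x)).
(* Projecting to degree [n] keeps the bidegrees [(i, n - i)]. At a primitive element only the two
   ends contribute, because [1] has degree 0. *)
have convE y : conv f g (pi n y) =
    \sum_(i < n.+1) conv (fun a => f (pi i a)) (fun b => g (pi (n - i) b)) y.
  elim/graded_ind: y => [y z IHy IHz|m y hy].
    rewrite (lmD (lpi n)) (lfD (lconv lf lg)) IHy IHz -big_split /=.
    by apply: eq_bigr => i _; rewrite (lfD (lconv _ _)) //; apply: lf_pi.
  have [e|ne] := eqVneq n m; first by rewrite -e in hy; rewrite hy; apply: conv_homE.
  rewrite (pi_hom hy ne) (lf0 (lconv lf lg)) big1 // => i _.
  by apply: conv_hom0 (hy) _ => //; rewrite subnKC // -ltnS.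
rewrite convE; under eq_bigr do rewrite (conv_prim (lf_pi _ lf) (lf_pi _ lg) px).
rewrite big_split /= big_ord_recr /= subnn hom1 big1 ?add0r; last first.
  move=> i _; rewrite (pi_hom hom1) ?(lf0 lg) ?mulr0 //.
  by rewrite subn_eq0 -ltnNge.
rewrite big_ord_recl /= subn0 hom1 big1 ?addr0 // => i _.
by rewrite (pi_hom hom1) ?(lf0 lf) ?mul0r.
Qed.

Lemma prim_lin a x y : prim Delta x -> prim Delta y -> prim Delta (a *: x + y).
Proof.
move=> px py f g lf lg; rewrite big_cons big_seq1 /= -/(conv f g _).
rewrite (lconv lf lg) !conv_prim // lf lg mulrDl !mulrDr addrACA !mulrA.
by rewrite [f 1 * a]mulrC.
Qed.

Lemma prim0 : prim Delta 0.
Proof.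
move=> f g lf lg; rewrite big_cons big_seq1 /= -/(conv f g _).
by rewrite (lf0 (lconv lf lg)) (lf0 lf) (lf0 lg) mul0r mulr0 addr0.
Qed.

Lemma prim_sum I (r : seq I) (Q : pred I) (F : I -> H) (c : I -> K) :
  (forall i, Q i -> prim Delta (F i)) -> prim Delta (\sum_(i <- r | Q i) c i *: F i).
Proof.
move=> pF; apply: (big_rec (prim Delta)); first exact: prim0.
by move=> i x Qi px; apply: prim_lin => //; apply: pF.
Qed.

(** Each [x] has finitely many non-zero components, so the sum of the [h n x] is finite. *)
Lemma graded_glue (h : nat -> H -> H) : (forall n, linear (h n)) ->
  (forall n x, h n (pi n x) = h n x) -> (forall n x, hom pi n (h n x)) ->
  exists2 g : H -> H, linear g & forall n x, pi n (g x) = h n x.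
Proof.
move=> lh hpi hh; have [N NP] := choice pi_bound.
have h0 n x : pi n x = 0 -> h n x = 0 by move=> x0; rewrite -hpi x0 (lm0 (lh n)).
have sumE M x : (forall k, (M <= k)%N -> pi k x = 0) ->
    forall n, pi n (\sum_(k < M) h k x) = h n x.
  move=> xM n; rewrite (lm_sum (lpi n)).
  have [ltn|leM] := ltnP n M.
    rewrite (bigD1 (Ordinal ltn)) //= hh big1 ?addr0 // => i ne.
    rewrite (pi_hom (hh i x)) //; apply: contra ne => /eqP e.
    by apply/eqP; apply: val_inj.
  rewrite h0 ?xM // big1 // => i _; rewrite (pi_hom (hh i x)) //.
  by rewrite gtn_eqF // (leq_trans (ltn_ord i)).
exists (fun x => \sum_(k < N x) h k x) => [a x y|n x]; last by apply: sumE (NP x) n.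
by apply: pi_ext => n; rewrite (lpi n) !(sumE _ _ (NP _)) lh.
Qed.

(** The counit axioms already fix the components of [Delta x] in bidegrees [(n, 0)] and [(0, n)];
    only the mixed ones have to vanish. *)
Lemma prim_criterion n x : hom pi n x -> (0 < n)%N ->
  (forall f g i j, lin_functional f -> lin_functional g -> (0 < i)%N -> (0 < j)%N ->
     (i + j)%N = n -> conv (fun a => f (pi i a)) (fun b => g (pi j b)) x = 0) ->
  prim Delta x.
Proof.
case: n => // n hx _ x0 f g lf lg; rewrite big_cons big_seq1 /= -/(conv f g x).
rewrite (conv_homE lf lg hx) big_ord_recr big_ord_recl /= subnn subn0 big1 ?addr0.
  rewrite addrC; congr (_ + _).
    have -> : f x * g 1 = conv f (fun b => eps b * g 1) x.
      by rewrite -(conv_epsr x lf) mulr_suml; apply: eq_bigr => p _; rewrite mulrA.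
    apply: (eq_conv_hom (n := n.+1)) => //; try exact: lf_pi.
      by apply: lf_scaler; apply: leps.
    move=> i j a b ijn ha hb; rewrite pi0E (lfZ lg).
    have [j0|j0] := posnP j; last by rewrite (eps_hom hb) // mul0r !mulr0.
    by rewrite -ijn j0 addn0 ha.
  have -> : f 1 * g x = conv (fun a => eps a * f 1) g x.
    rewrite -(conv_epsl x lg) mulr_sumr; apply: eq_bigr => p _.
    by rewrite mulrA [f 1 * _]mulrC.
  apply: (eq_conv_hom (n := n.+1)) => //; try exact: lf_pi.
    by apply: lf_scaler; apply: leps.
  move=> i j a b ijn ha hb; rewrite pi0E (lfZ lf).
  have [i0|i0] := posnP i; last by rewrite (eps_hom ha) // !mul0r.
  by rewrite -ijn i0 add0n hb.
move=> i _; apply: x0 => //; rewrite /bump /= add1n.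
  by rewrite subn_gt0 ltnS.
by rewrite subnKC // ltnS ltnW.
Qed.
Lemma piM n x y : pi n (x * y) = \sum_(i < n.+1) pi i x * pi (n - i)%N y.
Proof.
elim/graded_ind: x => [x x' IHx IHx'|a x hx].
  rewrite mulrDl (lmD (lpi n)) IHx IHx' -big_split; apply: eq_bigr => i _.
  by rewrite (lmD (lpi i)) mulrDl.
elim/graded_ind: y => [y y' IHy IHy'|b y hy].
  rewrite mulrDr (lmD (lpi n)) IHy IHy' -big_split; apply: eq_bigr => i _.
  by rewrite (lmD (lpi _)) mulrDr.
have [an|an] := leqP a n; last first.
  rewrite (pi_hom (homM hx hy)) ?big1 // => [i _|].
    by rewrite (pi_hom hx) ?mul0r // ltn_eqF // (leq_ltn_trans (leq_ord i)).
  by rewrite ltn_eqF // (leq_trans an) // leq_addr.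
rewrite (bigD1 (Ordinal (an : (a < n.+1)%N))) //= big1 ?addr0; last first.
  move=> i ne; rewrite (pi_hom hx) ?mul0r //.
rewrite hx; have [e|ne] := eqVneq (n - a)%N b.
  by rewrite e hy -(subnKC an) e; apply: homM.
rewrite (pi_hom hy ne) mulr0 (pi_hom (homM hx hy)) //.
by apply: contra ne => /eqP ->; rewrite addKn.
Qed.

Lemma epsM x y : eps (x * y) = eps x * eps y.
Proof. by case: HH => _ _ _ [[]]. Qed.

Lemma Hplus_pi n x : Hplus pi x -> Hplus pi (pi n x).
Proof. by rewrite /Hplus pi_pi => x0; case: eqP => // <-. Qed.

Lemma HplusM x y : Hplus pi y -> Hplus pi (x * y).
Proof. by rewrite !HplusE epsM => ->; rewrite mulr0. Qed.

End HopfBasics.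

(** * The structure given by free generators *)

Section BilinearForm.
Variables (K : fieldType) (H : algType K) (A : H -> H -> K).
Hypothesis bA : bilinear_form A.

Lemma bilr x : lin_functional (A x).
Proof. by move=> a y z; have [] := bA a y z x. Qed.

Lemma bill y : lin_functional (A^~ y).
Proof. by move=> a x z; have [] := bA a x z y. Qed.
End BilinearForm.

Lemma bilinearP (K : fieldType) (H : algType K) (A : H -> H -> K) :
  (forall x, lin_functional (A x)) -> (forall y, lin_functional (A^~ y)) ->
  bilinear_form A.
Proof. by move=> lr ll a x y z; split; [apply: ll | apply: lr]. Qed.

(* [vp] projects [T(V)] onto the words of length 1, and [lift] maps a word
   [v_1 ... v_n], [n >= 2], to [v_1 (x) v_2 ... v_n]. *)
Record free_structure (K : fieldType) (H : algType K) (pi : nat -> H -> H)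
    (eps : H -> K) (V : H -> Prop) (vp : H -> H) (lift : H -> seq (H * H)) : Prop := {
  fs_lin : forall a x y, V x -> V y -> V (a *: x + y);
  fs_pi : forall n x, V x -> V (pi n x);
  fs_plus : forall x, V x -> Hplus pi x;
  vp_lin : linear vp;
  vp_in : forall x, V (vp x);
  vp_id : forall x, V x -> vp x = x;
  vp_1 : vp 1 = 0;
  vp_mul : forall x y, Hplus pi x -> Hplus pi y -> vp (x * y) = 0;
  lift_in : forall x p, p \in lift x -> V p.1 /\ Hplus pi p.2;
  liftE : forall x, x = eps x *: 1 + vp x + \sum_(p <- lift x) p.1 * p.2;
  lift_lin : forall A, bilinear_form A ->
    lin_functional (fun x => \sum_(p <- lift x) A p.1 p.2);
  lift_mul : forall A x y, bilinear_form A ->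
    (forall v u z, V v -> Hplus pi u -> Hplus pi z -> A (v * u) z = A v (u * z)) ->
    Hplus pi x -> Hplus pi y -> \sum_(p <- lift (x * y)) A p.1 p.2 = A x y }.

Section Free.
Variables (K : fieldType) (H : algType K) (pi : nat -> H -> H).
Variables (Delta : H -> seq (H * H)) (eps : H -> K).
Hypothesis HH : graded_connected_hopf pi Delta eps.

Let leps := leps HH.
Let sep := functionals_separate_eq HH.

(** By freeness, a multilinear map on words in [V] has the same value on all expressions of an
    element. Hence [vp] and [lift], though read off from a chosen expression [r x], become linear
    once a functional or a bilinear form is applied. *)
Lemma free_structure_exists : is_free pi ->
  exists V vp lift, free_structure pi eps V vp lift.
Proof.
case=> V [V0 Vlin Vpi Vgen Vfree].
pose Vwords (s : seq (K * seq H)) := forall p v, p \in s -> v \in p.2 -> V v.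
have [r rP] := choice Vgen.
have VZ a x : V x -> V (a *: x) by move=> Vx; rewrite -[_ *: _]addr0; apply: Vlin.
have Vplus x : V x -> Hplus pi x.
  move=> Vx; have V1 : V (eps x *: 1) by rewrite -(pi0E HH); apply: Vpi.
  (* The one-letter word [eps x *: 1] and [eps x] times the empty word evaluate to the same element;
     tensor degree 0 then gives [eps x = 0]. *)
  have tz : tensor_words_zero [:: (1, [:: eps x *: 1 : H]); (- eps x, [::])].
    apply: Vfree => [p v|].
      by rewrite !inE => /orP[] /eqP -> //=; rewrite inE => /eqP ->.
    rewrite /words_eval big_cons !big_seq1 /= big_nil scale1r.
    by rewrite scaleNr subrr.
  have /eqP := tz 0%N (fun _ _ => 0) (fun _ => @lf_null _ _).
  rewrite !big_cons !big_nil /= big_ord0 mulr1 addr0 oppr_eq0 => /eqP e0.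
  exact/(HplusE HH).
have Veps x : V x -> eps x = 0 by move/Vplus/(HplusE HH).
(* [MF M x] is [M] evaluated at the tensor corresponding to [x]; [MF_eval] makes it independent of
   [r]. *)
pose MF (M : seq H -> K^o) x := \sum_(p <- r x) p.1 * M p.2.
have MF_eval (M : seq H -> K^o) s : multilinear_words M -> Vwords s ->
    MF M (words_eval s) = \sum_(p <- s) p.1 * M p.2.
  move=> mM Vs; apply/eqP; rewrite -subr_eq0; apply/eqP.
  have [Vr rE] := rP (words_eval s); set t := r _ in Vr rE *.
  have := @tensor_words_zero_multilinear K H
    (t ++ [seq (- p.1, p.2) | p <- s]) M mM.
  rewrite big_cat big_map /=; under [X in _ + X]eq_bigr do rewrite mulNr.
  rewrite sumrN; apply; apply: Vfree.
    move=> p v; rewrite mem_cat => /orP[tp|/mapP[q sq ->]]; first exact: Vr.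
    exact: (Vs q v sq).
  rewrite /words_eval big_cat big_map /=; under [X in _ + X]eq_bigr do rewrite scaleNr.
  by rewrite sumrN -/(words_eval s) -/(words_eval t) -rE subrr.
have MF_lin M : multilinear_words M -> lin_functional (MF M).
  move=> mM a x y; have [Vx xE] := rP x; have [Vy yE] := rP y.
  have e : a *: x + y = words_eval ([seq (a * p.1, p.2) | p <- r x] ++ r y).
    rewrite {1}xE {1}yE /words_eval big_cat big_map /= scaler_sumr.
    by congr (_ + _); apply: eq_bigr => p _; rewrite scalerA.
  rewrite e MF_eval //; last first.
    move=> p v; rewrite mem_cat => /orP[/mapP[q sq ->]|yp]; last exact: Vy.
    exact: (Vx q v sq).
  rewrite big_cat big_map /= mulr_sumr; congr (_ + _).
  by apply: eq_bigr => p _; rewrite mulrA.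
have eps_r x : eps x = \sum_(p <- r x | size p.2 == 0%N) p.1.
  have [Vx xE] := rP x; rewrite {1}xE /words_eval (lf_sum leps) [RHS]big_mkcond /=.
  apply: eq_big_seq => -[c [|v w]] xp /=; rewrite (lfZ leps).
    by rewrite big_nil (eps1 HH) mulr1.
  rewrite big_cons (epsM HH) (Veps v) ?mul0r ?mulr0 //.
  by apply: (Vx _ _ xp); rewrite /= mem_head.
have MF_mul (M : seq H -> K^o) v x : multilinear_words M -> V v ->
    MF M (v * x) = \sum_(p <- r x) p.1 * M (v :: p.2).
  move=> mM Vv; have [Vx xE] := rP x.
  have e : v * x = words_eval [seq (p.1, v :: p.2) | p <- r x].
    rewrite {1}xE /words_eval big_map mulr_sumr; apply: eq_bigr => p _ /=.
    by rewrite big_cons scalerAr.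
  rewrite e MF_eval ?big_map // => p w /mapP[q xq ->] /=.
  by rewrite inE => /orP[/eqP ->|] //; apply: Vx.
(* [M1] selects the words of length 1, and [M2] those of length at least 2, with the first letter
   split off. *)
pose M1 (l : H -> K) (w : seq H) : K^o := if size w == 1%N then l (head 0 w) else 0.
have mM1 l : lin_functional l -> multilinear_words (M1 l).
  move=> ll [|x u] [|y v] a w w'; rewrite /M1 /= ?scaler0 ?addr0 //;
  by rewrite ?size_cat /= ?addnS /= ?scaler0 ?addr0.
pose M2 (A : H -> H -> K) (w : seq H) : K^o :=
  if (1 < size w)%N then A (head 0 w) (\prod_(v <- behead w) v) else 0.
have mM2 A : bilinear_form A -> multilinear_words (M2 A).
  move=> bA [|x u] v a w w'; rewrite /M2 /=.
    by case: ifP => _; [apply: (bill bA) | rewrite scaler0 addr0].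
  rewrite !size_cat /= addnS ltnS /= !big_cat !big_cons /=.
  by rewrite !mulrDl mulrDr -!scalerAl -scalerAr (bilr bA).
pose vp x := \sum_(p <- r x | size p.2 == 1%N) p.1 *: head 0 p.2.
pose lift x := [seq (p.1 *: head 0 p.2, \prod_(v <- behead p.2) v) |
   p <- [seq p <- r x | (1 < size p.2)%N]].
have vpE l x : lin_functional l -> l (vp x) = MF (M1 l) x.
  move=> ll; rewrite /vp (lf_sum ll) big_mkcond; apply: eq_bigr => p _.
  by rewrite /M1; case: ifP => _; rewrite ?mulr0 ?(lfZ ll).
have liftA A x : bilinear_form A -> \sum_(p <- lift x) A p.1 p.2 = MF (M2 A) x.
  move=> bA; rewrite big_map big_filter big_mkcond; apply: eq_bigr => p _ /=.
  by rewrite /M2; case: ifP => _; rewrite ?mulr0 ?(lfZ (bill bA _)).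
have lvp : linear vp.
  move=> a x y; apply: sep => l ll.
  by rewrite ll !vpE // (MF_lin _ (mM1 l ll)).
have vpV x : V (vp x).
  rewrite /vp big_seq_cond; apply: (big_ind V) => // [y z Vy Vz|p /andP[xp /eqP sp]].
    by rewrite -[y]scale1r; apply: Vlin.
  apply: VZ; apply: (rP x).1 (xp) _; case: p.2 sp => //= v w _; exact: mem_head.
have vpid v : V v -> vp v = v.
  move=> Vv; apply: sep => l ll; rewrite vpE //.
  have {1}-> : v = words_eval [:: (1, [:: v])].
    by rewrite /words_eval !big_seq1 scale1r.
  rewrite MF_eval; [by rewrite big_seq1 mul1r|exact: mM1|].
  by move=> p w; rewrite inE => /eqP -> /=; rewrite inE => /eqP ->.
have one_eval : 1 = words_eval [:: (1, [::])] :> H.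
  by rewrite /words_eval !big_seq1 big_nil scale1r.
have V1 : Vwords [:: (1, [::])] by move=> p w; rewrite inE => /eqP ->.
have vp1 : vp 1 = 0.
  apply: sep => l ll; rewrite vpE // [X in MF _ X]one_eval MF_eval //; last exact: mM1.
  by rewrite big_seq1 mulr0 (lf0 ll).
have vpVmul v x : V v -> Hplus pi x -> vp (v * x) = 0.
  move=> Vv /(HplusE HH) x0; apply: sep => l ll.
  rewrite vpE // MF_mul //; last exact: mM1.
  transitivity (eps x * l v); last by rewrite x0 mul0r (lf0 ll).
  rewrite eps_r mulr_suml [RHS]big_mkcond; apply: eq_bigr => -[c [|y w]] _ //=.
  by rewrite mulr0.
have lift_V x p : p \in lift x -> V p.1 /\ Hplus pi p.2.
  case/mapP=> -[c w]; rewrite mem_filter => /andP[/= sw xp] ->.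
  case: w xp sw => // v [|v' w] // xp _ /=; split.
    by apply: VZ; apply: (rP x).1 (xp) _; rewrite mem_head.
  apply/(HplusE HH); rewrite big_cons (epsM HH) Veps ?mul0r //.
  by apply: (rP x).1 (xp) _; rewrite !inE eqxx orbT.
have xE x : x = eps x *: 1 + vp x + \sum_(p <- lift x) p.1 * p.2.
  have [_ {1}->] := rP x; rewrite eps_r /vp scaler_suml big_map big_filter.
  rewrite big_mkcond [X in _ + X + _]big_mkcond [X in _ + X]big_mkcond /=.
  rewrite -[X in X + _]big_split -big_split; apply: eq_bigr => -[c [|v [|v' w]]] _ /=.
  - by rewrite big_nil !addr0.
  - by rewrite big_seq1 add0r addr0.
  - by rewrite !add0r !big_cons scalerAl.
have lift_Vmul A v x : bilinear_form A -> V v -> Hplus pi x ->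
    \sum_(p <- lift (v * x)) A p.1 p.2 = A v x.
  move=> bA Vv /(HplusE HH) x0; rewrite liftA // MF_mul //; last exact: mM2.
  have [_ {2}->] := rP x; rewrite (lf_sum (bilr bA v)).
  (* The empty word of [r x] becomes [[:: v]] on the left, where [M2] is 0; on the right it gives
     [A v 1] with total coefficient [eps x = 0]. *)
  have e0 : (\sum_(p <- r x | size p.2 == 0%N) p.1) * A v 1 = 0.
    by rewrite -eps_r x0 mul0r.
  rewrite -[RHS]subr0 -[X in _ - X]e0 mulr_suml [X in _ - X]big_mkcond -sumrN -big_split.
  apply: eq_bigr => -[c [|y w]] _ /=; rewrite (lfZ (bilr bA _)).
    by rewrite big_nil mulr0 subrr.
  by rewrite subr0.
exists V, vp, lift; split=> //.
- move=> x y x0 y0; rewrite {1}(xE x) ((HplusE HH x).1 x0) scale0r add0r mulrDl.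
  rewrite (lmD lvp) vpVmul // add0r mulr_suml (lm_sum lvp) big_seq big1 // => p.
  by case/lift_V=> Vp p0; rewrite -mulrA vpVmul //; apply: (HplusM HH).
- by move=> A bA a x y; rewrite !liftA //; apply: MF_lin; apply: mM2.
- move=> A x y bA assA x0 y0; rewrite liftA //.
  have lM := MF_lin _ (mM2 A bA).
  have e : x = vp x + \sum_(p <- lift x) p.1 * p.2.
    by rewrite {1}[x]xE ((HplusE HH x).1 x0) scale0r add0r.
  suff : MF (M2 A) ((vp x + \sum_(p <- lift x) p.1 * p.2) * y) =
         A (vp x + \sum_(p <- lift x) p.1 * p.2) y by rewrite -e.
  rewrite mulrDl (lfD lM) (lfD (bill bA y)); congr (_ + _).
    by rewrite -liftA // lift_Vmul.
  (* For a left factor [p.1 * p.2] with [p.1] in [V], the product is regrouped so that [lift_Vmul]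
     applies, and [assA] moves [p.2] back. *)
  rewrite mulr_suml (lf_sum lM) (lf_sum (bill bA y)).
  rewrite big_seq [RHS]big_seq; apply: eq_bigr => p /lift_V[Vp p0].
  by rewrite -mulrA -liftA // lift_Vmul ?assA //; apply: (HplusM HH).
Qed.
End Free.

(** * Decomposable elements and representatives of primitive classes *)

Section Projections.
Variables (K : fieldType) (H : algType K) (pi : nat -> H -> H).
Variables (Delta : H -> seq (H * H)) (eps : H -> K).
Hypothesis HH : graded_connected_hopf pi Delta eps.
Variables (V : H -> Prop) (vp : H -> H) (lift : H -> seq (H * H)).
Hypothesis FS : free_structure pi eps V vp lift.

Let lpi := lpi HH.
Let lvp := vp_lin FS.

Lemma vp_pi n x : vp (pi n x) = pi n (vp x).
Proof.
rewrite {1}(liftE FS x) !(lmD (lpi n)) !(lmD lvp) (lmZ (lpi n)) (lmZ lvp).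
have -> : vp (pi n 1) = 0.
  case: n => [|n]; first by rewrite (hom1 HH) (vp_1 FS).
  by rewrite (pi_hom HH (hom1 HH)) // (lm0 lvp).
rewrite scaler0 add0r (vp_id FS); last exact/(fs_pi FS)/(vp_in FS).
rewrite (lm_sum (lpi n)) (lm_sum lvp) big_seq big1 ?addr0 // => p.
case/(lift_in FS)=> /(fs_plus FS) p1 p2; rewrite (piM HH) (lm_sum lvp) big1 // => i _.
by rewrite (vp_mul FS) //; apply: (Hplus_pi HH).
Qed.

Lemma vp_Hplus2 x : Hplus2 pi x -> vp x = 0.
Proof.
case=> s [sP ->]; rewrite (lm_sum lvp) big_seq big1 // => p /sP[].
exact: (vp_mul FS).
Qed.

Lemma Hplus2_lift x : Hplus pi x -> vp x = 0 -> x = \sum_(p <- lift x) p.1 * p.2.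
Proof.
move=> /(HplusE HH) x0 v0.
by rewrite {1}(liftE FS x) x0 v0 scale0r !add0r.
Qed.

Lemma Hplus2P x : Hplus pi x -> vp x = 0 -> Hplus2 pi x.
Proof.
move=> x0 v0; exists (lift x); split; last exact: Hplus2_lift.
by move=> p /(lift_in FS)[/(fs_plus FS)].
Qed.

(** An element of [H^+] killed by [vp] is a sum of products; in degree [n] these split into products
    of homogeneous elements of positive degrees. *)
Lemma decomposable_ind n (R : H -> Prop) : R 0 ->
  (forall x y, R x -> R y -> R (x + y)) ->
  (forall i j x y, (0 < i)%N -> (0 < j)%N -> (i + j)%N = n ->
     hom pi i x -> hom pi j y -> R (x * y)) ->
  forall w, hom pi n w -> (0 < n)%N -> vp w = 0 -> R w.
Proof.
move=> R0 RD Rmul w hw n0 vw.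
rewrite -hw (Hplus2_lift (Hplus_hom HH hw n0) vw) (lm_sum (lpi n)) big_seq.
apply: (big_ind R) => // p /(lift_in FS)[/(fs_plus FS) p1 p2].
rewrite (piM HH); apply: (big_ind R) => // k _.
have [->|k0] := posnP k; first by rewrite p1 mul0r.
have [->|nk0] := posnP (n - k)%N; first by rewrite p2 mulr0.
by apply: Rmul k0 nk0 _ (hom_pi HH _ _) (hom_pi HH _ _); rewrite subnKC // -ltnS.
Qed.

(** The primitive elements of degree [n] are spanned by a finite family [ys]. A dual system of the
    images of [ys] under [vp] supplies the coefficients, so [rho x] depends only on [vp x]. *)
Lemma prim_section_hom n : exists rho : H -> H,
  [/\ linear rho, forall x, prim Delta (rho x), forall x, hom pi n (rho x),
      forall x, vp x = 0 -> rho x = 0 &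
      forall x, prim Delta x -> hom pi n x -> vp (rho x) = vp x].
Proof.
have [d [c [t [lc lt ht ct tc]]]] := hom_coordinates HH n.
have [|a x y px py|G GP] := @subspace_rowspace K d (fun w => prim Delta (t w)).
- by rewrite (lm0 lt); apply: prim0 HH.
- by rewrite lt; apply: (prim_lin HH).
pose ys := [seq t (row i G) | i <- enum 'I_d].
have prim_t i : prim Delta (t (row i G)) by apply/GP; apply: row_sub.
have [h [lh sh]] := dual_system (map vp ys).
have ysP i : (i < size ys)%N -> prim Delta ys`_i /\ hom pi n ys`_i.
  by move=> /(mem_nth 0) /mapP[j _ ->].
exists (fun x => \sum_(i < size ys) h i (vp (pi n x)) *: ys`_i); split.
- move=> a x y; rewrite scaler_sumr -big_split; apply: eq_bigr => i _.
  by rewrite (lpi n) lvp lh scalerDl scalerA.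
- by move=> x; apply: (prim_sum HH) => i _; have [] := ysP i (ltn_ord i).
- move=> x; apply: (hom_sum HH) => i _; apply: (homZ HH).
  by have [] := ysP i (ltn_ord i).
- move=> x v0; rewrite big1 // => i _.
  by rewrite vp_pi v0 (lm0 (lpi n)) (lf0 (lh i)) scale0r.
move=> x px hx; have /submxP[D cE] : (c x <= G)%MS by apply/GP; rewrite tc hx.
have vxE : vp x = \sum_j D 0 j *: vp (t (row j G)).
  rewrite -{1}hx -tc cE mulmx_sum_row (lm_sum lt) (lm_sum lvp).
  by apply: eq_bigr => j _; rewrite (lmZ lt) (lmZ lvp).
apply: (functionals_separate_eq HH) => l ll; rewrite hx.
have lR : lin_functional (fun w => \sum_(i < size ys) h i w * l (vp ys`_i)).
  by apply: lf_bigsum => i; apply: lf_scaler.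
rewrite (lm_sum lvp) (lf_sum ll).
transitivity (\sum_(i < size ys) h i (vp x) * l (vp ys`_i)).
  by apply: eq_bigr => i _; rewrite (lmZ lvp) (lfZ ll).
rewrite vxE (lf_sum lR) (lf_sum ll); apply: eq_bigr => j _.
rewrite (lfZ lR) (lfZ ll); congr (_ * _).
rewrite [RHS]sh //; last first.
  by rewrite /ys -map_comp; apply/mapP; exists j; rewrite ?mem_enum.
rewrite (size_map vp ys); apply: eq_bigr => i _; by rewrite (nth_map 0).
Qed.

(* [rho] factors through [H^+/H^{+2}] and is there a projection onto the image of
   [Prim(H)], followed by a choice of primitive representatives. *)
Lemma prim_section : exists rho : H -> H,
  [/\ linear rho, forall x, prim Delta (rho x),
      forall n x, rho (pi n x) = pi n (rho x),
      forall x, vp x = 0 -> rho x = 0 &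
      forall x, prim Delta x -> vp (rho x) = vp x].
Proof.
have [h hP] := choice prim_section_hom.
have [||n x|rho lrho rhoE] := @graded_glue _ _ _ _ _ HH (fun n x => h n (pi n x)).
- by move=> n a x y; have [lh _ _ _ _] := hP n; rewrite (lpi n) lh.
- by move=> n x; rewrite (hom_pi HH).
- by have [] := hP n.
have hprim n x : prim Delta (h n x) by have [] := hP n.
exists rho; split=> // [x|n x|x v0|x px].
- have [N NP] := pi_bound HH (rho x); rewrite (sum_pi HH NP).
  rewrite (eq_bigr (fun n : 'I_N => 1 *: h n (pi n x))) => [|n _].
    by apply: (prim_sum HH).
  by rewrite rhoE scale1r.
- apply: (pi_ext HH) => m; rewrite rhoE !(pi_pi HH); case: eqP => [->|_].
    by rewrite rhoE.
  by have [lh _ _ _ _] := hP m; rewrite (lm0 lh).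
- apply: (pi_ext HH) => n; rewrite rhoE (lm0 (lpi n)).
  by have [_ _ _ -> //] := hP n; rewrite vp_pi v0 (lm0 (lpi n)).
- apply: (pi_ext HH) => n; rewrite -!vp_pi rhoE.
  have [_ _ _ _ e] := hP n; apply: e; first exact: (prim_pi HH).
  exact: (hom_pi HH).
Qed.
End Projections.

(** * Construction of the pairing *)

Section Pairing.
Variables (K : fieldType) (H : algType K) (pi : nat -> H -> H).
Variables (Delta : H -> seq (H * H)) (eps : H -> K).
Hypothesis HH : graded_connected_hopf pi Delta eps.
Variables (V : H -> Prop) (vp : H -> H) (lift : H -> seq (H * H)).
Hypothesis FS : free_structure pi eps V vp lift.

Let lpi := lpi HH.
Let leps := leps HH.
Local Notation conv := (convolution Delta).
Implicit Types P : H -> H -> K.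

(** Turns the rule for products on the right into the rule for products on the left, so that both
    share the lemmas below. *)
Definition flip P x y := P y x.

Definition homogeneous_form P :=
  forall i j x y, hom pi i x -> hom pi j y -> i != j -> P x y = 0.

Definition multiplicative n P := forall k x y z, (k <= n)%N -> hom pi k z ->
  P (x * y) z = conv (P x) (P y) z.

Lemma bilinear_flip P : bilinear_form P -> bilinear_form (flip P).
Proof. by move=> bP a x y z; have [? ?] := bP a x y z. Qed.

Lemma bilinear_conv P y : bilinear_form P ->
  bilinear_form (fun a b => conv (P a) (P b) y).
Proof.
move=> bP; apply: bilinearP => z; apply: lf_bigsum => p.
  exact: lf_scale (bill bP _).
exact: lf_scaler (bill bP _).
Qed.

Lemma form1r P x b : bilinear_form P -> (forall x, P x 1 = eps x) ->
  hom pi 0 b -> P x b = eps b * eps x.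
Proof.
move=> bP P1 /(hom0E HH) ->.
by rewrite (lfZ (bilr bP x)) P1 (lfZ leps) (eps1 HH) mulr1.
Qed.

(** The value forced on a product in degree [n.+1] does not depend on the factorisation: by
    coassociativity the form [conv (P a) (P b) y] satisfies the associativity condition of
    [lift_mul]. *)
Lemma lift_mul_conv n P y a b : bilinear_form P -> (forall x, P x 1 = eps x) ->
  multiplicative n P -> hom pi n.+1 y -> Hplus pi a -> Hplus pi b ->
  \sum_(p <- lift (a * b)) conv (P p.1) (P p.2) y = conv (P a) (P b) y.
Proof.
move=> bP P1 mP hy.
apply: (lift_mul FS (A := fun a b => conv (P a) (P b) y)); first exact: bilinear_conv.
move=> v u z Vv /(HplusE HH) u0 /(HplusE HH) z0.
have v0 := (HplusE HH v).1 (fs_plus FS Vv).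
have lP := bilr bP.
(* Both sides equal the triple convolution. The extreme bidegrees vanish because [eps z = 0] and
   [eps v = 0], so multiplicativity is used only up to degree [n]. *)
transitivity (conv (conv (P v) (P u)) (P z) y).
  apply: (eq_conv_hom HH) hy _ => //; first exact: (lconv HH).
  move=> i [|j] c d ijn hc hd; first by rewrite (form1r z bP P1 hd) z0 !mulr0.
  by congr (_ * _); apply: mP hc; rewrite -ltnS -ijn -[X in (X <= _)%N]addn1 leq_add2l.
rewrite (convA HH) //; apply: (eq_conv_hom HH) hy _ => //; first exact: (lconv HH).
move=> [|i] j c d ijn hc hd; first by rewrite (form1r v bP P1 hc) v0 !mulr0 !mul0r.
by congr (_ * _); apply/esym; apply: mP hd; rewrite -ltnS -ijn addSn ltnS leq_addl.
Qed.

(** The two rules agree on a product against a product: as [Delta] is multiplicative, both sides are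
    the same sum over four coproducts of products of four values of [P]. *)
Lemma conv_mul_sym n P i j c d a b : bilinear_form P ->
  multiplicative n P -> multiplicative n (flip P) ->
  (i <= n)%N -> (j <= n)%N -> hom pi i c -> hom pi j d ->
  forall i' j', (i' <= n)%N -> (j' <= n)%N -> hom pi i' a -> hom pi j' b ->
  conv (P c) (P d) (a * b) = conv (flip P a) (flip P b) (c * d).
Proof.
move=> bP mP mPf ci dj hc hd i' j' ai bj ha hb.
have lP := bilr bP; have lPf := bilr (bilinear_flip bP).
rewrite !(convM HH) //.
under eq_bigr => p _. under eq_bigr => q _.
  rewrite -[P c _]/(flip P _ c) -[P d _]/(flip P _ d).
  rewrite (mPf _ _ _ _ ci hc) (mPf _ _ _ _ dj hd) /convolution big_distrlr /=.
over. over.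
under [RHS]eq_bigr => p _. under eq_bigr => q _.
  rewrite /flip (mP _ _ _ _ ai ha) (mP _ _ _ _ bj hb) /convolution big_distrlr /=.
over. over.
under eq_bigr do rewrite exchange_big /=.
rewrite exchange_big /=; apply: eq_bigr => r _.
under eq_bigr do rewrite exchange_big /=.
rewrite exchange_big /=; apply: eq_bigr => s _.
by apply: eq_bigr => p _; apply: eq_bigr => q _; rewrite mulrACA.
Qed.

(** Units, homogeneity and the agreement of [P'] with [P] outside degree [m] settle everything but
    products of two elements of positive degrees with sum [m]. *)
Lemma multiplicative_step m P P' : bilinear_form P' -> homogeneous_form P' ->
  (forall y, P' 1 y = eps y) ->
  (forall i x y, i != m -> hom pi i x -> P' x y = P x y) ->
  (forall i x y, i != m -> hom pi i y -> P' x y = P x y) ->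
  (forall k x y z, (k < m)%N -> hom pi k z -> P (x * y) z = conv (P x) (P y) z) ->
  (forall i j x y z, (0 < i)%N -> (0 < j)%N -> (i + j)%N = m -> hom pi i x ->
     hom pi j y -> hom pi m z -> P' (x * y) z = conv (P x) (P y) z) ->
  multiplicative m P'.
Proof.
move=> bP hP P1 lowl lowr mP topP k x y z km hz.
have lP := bilr bP; have rP := bill bP.
have bc := bilinear_conv z bP.
elim/(graded_ind HH): x => [x x' IHx IHx'|i x hx].
  by rewrite mulrDl (lfD (rP _)) IHx IHx' (lfD (bill bc y)).
elim/(graded_ind HH): y => [y y' IHy IHy'|j y hy].
  by rewrite mulrDr (lfD (rP _)) IHy IHy' (lfD (bilr bc x)).
have P1E : P' 1 =1 eps by move=> u; apply: P1.
case: i hx => [|i] hx.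
  rewrite (hom0E HH hx) (lfZ (bill bc y)) -scalerAl mul1r (lfZ (rP _)).
  by rewrite (eq_conv _ P1E (frefl _)) (conv_epsl HH).
case: j hy => [|j] hy.
  rewrite (hom0E HH hy) (lfZ (bilr bc x)) -scalerAr mulr1 (lfZ (rP _)).
  by rewrite (eq_conv _ (frefl _) P1E) (conv_epsr HH).
have [ijk|ijk] := eqVneq (i.+1 + j.+1)%N k; last first.
  rewrite (hP _ _ _ _ (homM HH hx hy) hz) //; apply/esym.
  transitivity (conv (fun _ => 0) (fun _ => 0) z).
    apply: (eq_conv_hom HH) (hz) _ => //; try exact: lf_null.
    move=> i' j' a b e ha hb; rewrite mulr0.
    have [ei|ni] := eqVneq i.+1 i'; last by rewrite (hP _ _ _ _ hx ha) // mul0r.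
    rewrite (hP _ _ _ _ hy hb) ?mulr0 //; apply: contra ijk => /eqP ->.
    by rewrite ei e.
  by rewrite /convolution big1 // => p _; rewrite mul0r.
(* Both factors have positive degree, so both degrees are below [m] and [P'] may be replaced by
   [P]. *)
have im : i.+1 != m by rewrite ltn_eqF // (leq_trans _ km) // -ijk addnS ltnS leq_addr.
have jm : j.+1 != m by rewrite ltn_eqF // (leq_trans _ km) // -ijk addSn ltnS leq_addl.
rewrite (eq_conv _ (fun u => lowl _ _ u im hx) (fun u => lowl _ _ u jm hy)).
have [e|ne] := eqVneq k m; first by apply: topP hx hy _; rewrite -?e.
by rewrite (lowr _ _ _ ne hz) (mP k) // ltn_neqAle ne.
Qed.

(** * The pairing, degree by degree *)

Variables (e : H -> H) (beta : H -> H -> K).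
Hypothesis le : linear e.
Hypothesis e_pi : forall n x, e (pi n x) = pi n (e x).
Hypothesis e_1 : e 1 = 0.
Hypothesis e_mul : forall x y, Hplus pi x -> Hplus pi y -> e (x * y) = 0.
Hypothesis e_idem : forall x, e (e x) = e x.
Hypothesis vp_e : forall x, vp (e x) = vp x.
Hypothesis bbeta : bilinear_form beta.
Hypothesis hbeta : homogeneous_form beta.

(* [e] is the projection onto the chosen complement of [H^{+2}] in [H^+], so
   [x - e x] lies in [H^{+2}] up to a scalar. *)
Definition degree_piece P x y :=
  beta (e x) (e y) + \sum_(p <- lift (x - e x)) conv (P p.1) (P p.2) y
  + \sum_(p <- lift (y - e y)) conv (flip P p.1) (flip P p.2) (e x).

(** Stage [n] is correct up to degree [n] and zero above, so the value in degree [n.+1] is simply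
    added. *)
Fixpoint partial_pairing n x y : K :=
  if n is n'.+1 then
    partial_pairing n' x y +
    degree_piece (partial_pairing n') (pi n x) (pi n y)
  else eps x * eps y.

Record partial_hopf_pairing n P : Prop := {
  ph_bilinear : bilinear_form P;
  ph_hom : homogeneous_form P;
  ph_1l : forall y, P 1 y = eps y;
  ph_1r : forall x, P x 1 = eps x;
  ph_ml : multiplicative n P;
  ph_mr : multiplicative n (flip P);
  ph_e : forall k x y, (0 < k <= n)%N -> hom pi k x -> hom pi k y ->
    P (e x) (e y) = beta (e x) (e y);
  ph_top : forall k x y, (n < k)%N -> hom pi k x -> P x y = 0 }.

Lemma hom_e n x : hom pi n x -> hom pi n (e x).
Proof. by rewrite /hom -e_pi => ->. Qed.

Lemma linear_sube : linear (fun x => x - e x).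
Proof. by move=> a x y; rewrite le scalerBr opprD addrACA. Qed.

Lemma sum_lift0 A : bilinear_form A -> \sum_(p <- lift 0) A p.1 p.2 = 0.
Proof. by move=> bA; apply: (lf0 (lift_lin FS bA)). Qed.

Lemma bilinear_degree_piece P : bilinear_form P -> bilinear_form (degree_piece P).
Proof.
move=> bP; have bPf := bilinear_flip bP.
apply: bilinearP => [x|y]; move=> a.
  move=> y z; rewrite /degree_piece linear_sube le (bilr bbeta).
  rewrite (lift_lin FS (bilinear_conv (e x) bPf)).
  have -> : \sum_(p <- lift (x - e x)) conv (P p.1) (P p.2) (a *: y + z) =
      a * (\sum_(p <- lift (x - e x)) conv (P p.1) (P p.2) y) +
      \sum_(p <- lift (x - e x)) conv (P p.1) (P p.2) z.
    rewrite mulr_sumr -big_split; apply: eq_bigr => p _.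
    exact: (lconv HH (bilr bP _) (bilr bP _)).
  by rewrite !mulrDr [RHS]addrACA [X in _ = X + _]addrACA.
move=> x z; rewrite /degree_piece linear_sube le (bill bbeta).
rewrite (lift_lin FS (bilinear_conv y bP)).
have -> : \sum_(p <- lift (y - e y)) conv (flip P p.1) (flip P p.2) (a *: e x + e z) =
    a * (\sum_(p <- lift (y - e y)) conv (flip P p.1) (flip P p.2) (e x)) +
    \sum_(p <- lift (y - e y)) conv (flip P p.1) (flip P p.2) (e z).
  rewrite mulr_sumr -big_split; apply: eq_bigr => p _.
  exact: (lconv HH (bilr bPf _) (bilr bPf _)).
by rewrite !mulrDr [RHS]addrACA [X in _ = X + _]addrACA.
Qed.

Section Step.
Variables (n : nat) (P : H -> H -> K).
Hypothesis good : partial_hopf_pairing n P.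
Let bP := ph_bilinear good.
Let bPf := bilinear_flip bP.
Local Notation Q := (degree_piece P).
Let bQ := bilinear_degree_piece bP.
Local Notation m := n.+1.

Lemma degree_piece_mull i j x y z : (0 < i)%N -> (0 < j)%N ->
  hom pi i x -> hom pi j y -> hom pi m z -> Q (x * y) z = conv (P x) (P y) z.
Proof.
move=> i0 j0 hx hy hz.
have x0 := Hplus_hom HH hx i0; have y0 := Hplus_hom HH hy j0.
rewrite /degree_piece e_mul // subr0 (lf0 (bill bbeta _)) add0r.
rewrite [X in _ + X]big1 ?addr0; last first.
  by move=> p _; apply: (lf0 (lconv HH (bilr bPf _) (bilr bPf _))).
by apply: (lift_mul_conv (n := n)) => //; [apply: (ph_1r good) | apply: (ph_ml good)].
Qed.

(** On [e x] the rule is the last summand of [degree_piece]. On [x - e x], a sum of products, it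
    follows from the left rule and [conv_mul_sym]. *)
Lemma degree_piece_mulr i j x y z : (0 < i)%N -> (0 < j)%N -> (i + j)%N = m ->
  hom pi i y -> hom pi j z -> hom pi m x ->
  Q x (y * z) = conv (flip P y) (flip P z) x.
Proof.
move=> i0 j0 ijm hy hz hx.
have y0 := Hplus_hom HH hy i0; have z0 := Hplus_hom HH hz j0.
have lc := lconv HH (bilr bPf y) (bilr bPf z).
have im : (i <= n)%N by rewrite -ltnS -ijm -[X in (X < _)%N]addn0 ltn_add2l.
have jm : (j <= n)%N by rewrite -ltnS -ijm -[X in (X < _)%N]add0n ltn_add2r.
rewrite -[x](subrK (e x)) (lfD (bill bQ _)) (lfD lc); congr (_ + _); last first.
  rewrite /degree_piece e_idem subrr (sum_lift0 (bilinear_conv _ bP)) addr0.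
  rewrite e_mul // (lf0 (bilr bbeta _)) add0r subr0.
  apply: (lift_mul_conv (n := n)) => //; [exact: (ph_1l good) | exact: (ph_mr good) |].
  exact: hom_e.
have hw : hom pi m (x - e x).
  by rewrite /hom (lmB (lpi m)) hx -e_pi hx.
set w := x - e x in hw *.
have vw : vp w = 0 by rewrite /w (lmB (vp_lin FS)) vp_e subrr.
clearbody w; move: w hw (ltn0Sn n) vw.
apply: (decomposable_ind HH FS) => [|u v IHu IHv|k l u v k0 l0 klm hu hv].
- by rewrite (lf0 (bill bQ _)) (lf0 lc).
- by rewrite (lfD (bill bQ _)) (lfD lc) IHu IHv.
have kn : (k <= n)%N by rewrite -ltnS -klm -[X in (X < _)%N]addn0 ltn_add2l.
have ln : (l <= n)%N by rewrite -ltnS -klm -[X in (X < _)%N]add0n ltn_add2r.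
have hyz : hom pi m (y * z) by rewrite -ijm; apply: (homM HH).
rewrite (degree_piece_mull _ _ hu hv hyz) //.
exact: (conv_mul_sym bP (ph_ml good) (ph_mr good) kn ln hu hv im jm hy hz).
Qed.

Lemma partial_hopf_pairing_step :
  partial_hopf_pairing m (fun x y => P x y + Q (pi m x) (pi m y)).
Proof.
set P' := fun x y => _.
have bP' : bilinear_form P'.
  apply: bilinearP => [x|y] a u v; rewrite /P' (lpi m).
    by rewrite (bilr bP) (bilr bQ) addrACA -mulrDr.
  by rewrite (bill bP) (bill bQ) addrACA -mulrDr.
have lowl i x y : i != m -> hom pi i x -> P' x y = P x y.
  by move=> im hx; rewrite /P' (pi_hom HH hx) 1?eq_sym // (lf0 (bill bQ _)) addr0.
have lowr i x y : i != m -> hom pi i y -> P' x y = P x y.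
  by move=> im hy; rewrite /P' (pi_hom HH hy) 1?eq_sym // (lf0 (bilr bQ _)) addr0.
have hP' : homogeneous_form P'.
  move=> i j x y hx hy ij; have [im|im] := eqVneq i m; last first.
    by rewrite (lowl i) //; apply: (ph_hom good) hx hy ij.
  rewrite (lowr j) //; first exact: (ph_hom good) hx hy ij.
  by rewrite -im eq_sym.
have top k x y : (n < k)%N -> hom pi k x -> P x y = 0 := @ph_top _ _ good k x y.
have topr k x y : (n < k)%N -> hom pi k y -> P x y = 0.
  move=> nk hy; elim/(graded_ind HH): x => [x x' IHx IHx'|i x hx].
    by rewrite (lfD (bill bP y)) IHx IHx' addr0.
  have [ik|ik] := eqVneq i k; last exact: (ph_hom good) hx hy ik.
  by apply: top hx; rewrite ik.
have m_neq0 : 0%N != m by [].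
split=> //.
- by move=> y; rewrite (lowl 0%N) //; [apply: (ph_1l good) | apply: (hom1 HH)].
- by move=> x; rewrite (lowr 0%N) //; [apply: (ph_1r good) | apply: (hom1 HH)].
- apply: (multiplicative_step (P := P)) => //.
  + by move=> y; rewrite (lowl 0%N) //; [apply: (ph_1l good) | apply: (hom1 HH)].
  + by move=> k x y z km hz; apply: (ph_ml good) hz.
  move=> i j x y z i0 j0 ijm hx hy hz; rewrite /P'.
  have hxy : hom pi m (x * y) by rewrite -ijm; apply: (homM HH).
  by rewrite (top m) // add0r hxy hz (degree_piece_mull _ _ hx hy).
- apply: (multiplicative_step (P := flip P)).
  + exact: bilinear_flip.
  + by move=> i j x y hx hy ij; apply: hP' hy hx _; rewrite eq_sym.
  + by move=> y; rewrite /flip (lowr 0%N) //; [apply: (ph_1r good) | apply: (hom1 HH)].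
  + by move=> i x y im hx; apply: lowr hx.
  + by move=> i x y im hy; apply: lowl hy.
  + by move=> k x y z km hz; apply: (ph_mr good) hz.
  move=> i j x y z i0 j0 ijm hx hy hz; rewrite /flip /P'.
  have hxy : hom pi m (x * y) by rewrite -ijm; apply: (homM HH).
  by rewrite (top m) // add0r hxy hz (degree_piece_mulr _ _ ijm hx hy).
- move=> k x y /andP[k0 km] hx hy; have [ke|kn] := eqVneq k m; last first.
    rewrite (lowl k) ?(ph_e good (k := k)) //; last exact: hom_e.
    by rewrite k0 -ltnS ltn_neqAle kn.
  rewrite ke in hx hy; rewrite /P' !hom_e // (top m _ _ (ltnSn n) (hom_e hx)) add0r.
  rewrite /degree_piece !e_idem !subrr (sum_lift0 (bilinear_conv _ bP)).
  by rewrite (sum_lift0 (bilinear_conv _ bPf)) !addr0.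
- move=> k x y mk hx; rewrite (lowl k) //; last by rewrite gtn_eqF.
  by apply: top hx; apply: ltnW.
Qed.
End Step.

Lemma partial_hopf_pairingP n : partial_hopf_pairing n (partial_pairing n).
Proof.
elim: n => [|n IH]; last exact: partial_hopf_pairing_step.
have mul0 : multiplicative 0 (fun x y => eps x * eps y).
  move=> k x y z; rewrite leqn0 => /eqP -> hz; rewrite (epsM HH) {2}(hom0E HH hz).
  have l t : lin_functional (fun y => eps t * eps y) by apply: lf_scale.
  by rewrite (lfZ (lconv HH (l x) (l y))) (conv1 HH) // (eps1 HH) !mulr1 mulrC.
split=> /=.
- by apply: bilinearP => z; [apply: lf_scale | apply: lf_scaler].
- move=> i j x y hx hy; case: i hx => [|i] hx; case: j hy => [|j] hy //.
    by rewrite (eps_hom HH hy) // mulr0.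
  by rewrite (eps_hom HH hx) // mul0r.
  by rewrite (eps_hom HH hx) // mul0r.
- by move=> y; rewrite (eps1 HH) mul1r.
- by move=> y; rewrite (eps1 HH) mulr1.
- exact: mul0.
- move=> k x y z k0 hz; rewrite /flip mulrC (mul0 k) //.
  by apply: eq_conv => u; rewrite mulrC.
- by move=> k x y; rewrite ltnNge andNb.
- by move=> k x y k0 hx; rewrite (eps_hom HH hx) // mul0r.
Qed.

Local Notation T := partial_pairing.

(** The stages are constant once they reach the degree of the first argument; the pairing is this
    stable value. *)
Lemma hopf_pairing_exists : exists P,
  hopf_pairing pi Delta eps P /\ forall x y, P (e x) (e y) = beta (e x) (e y).
Proof.
have [N NP] := choice (pi_bound HH).
have gT := partial_hopf_pairingP.
have bT n := ph_bilinear (gT n).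
have stable n n' x y : (forall k, (n < k)%N -> pi k x = 0) -> (n <= n')%N ->
    T n' x y = T n x y.
  move=> xn; elim: n' => [|n' IH]; first by rewrite leqn0 => /eqP ->.
  rewrite leq_eqVlt => /orP[/eqP -> //|nn']; rewrite /= xn //.
  by rewrite (lf0 (bill (bilinear_degree_piece (bT n')) _)) addr0; apply: IH.
(* No component of [x] has degree [N x] or more, so every later stage gives the same value. *)
pose P x y := T (N x) x y.
have PE n x y : (forall k, (n < k)%N -> pi k x = 0) -> P x y = T n x y.
  move=> xn; rewrite -(stable n (maxn n (N x))) ?leq_maxl // /P.
  by apply/esym; apply: stable; rewrite ?leq_maxr // => k /ltnW; apply: NP.
have PN n x y : (N x <= n)%N -> P x y = T n x y.
  by move=> Nn; apply: PE => k nk; apply: NP; apply: leq_trans Nn (ltnW nk).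
have Phom n k x y : hom pi k x -> (k <= n)%N -> P x y = T n x y.
  move=> hx kn; apply: PE => k' nk; rewrite (pi_hom HH hx) // gtn_eqF //.
  exact: leq_ltn_trans nk.
have bP : bilinear_form P.
  apply: bilinearP => [x|y a x z]; first exact: (bilr (bT _)).
  pose n := (N x + N z + N (a *: x + z)%R)%N.
  rewrite !(PN n) /n ?leq_addl //; first exact: (bill (bT _)).
    by rewrite addnAC leq_addl.
  by rewrite -addnA leq_addr.
have hP : homogeneous_form P by move=> i j x y hx hy; apply: (ph_hom (gT _)) hx hy.
exists P; split; last first.
  move=> x y; elim/(graded_ind HH): x => [x x' IHx IHx'|i x hx].
    by rewrite (lmD le) (lfD (bill bP _)) IHx IHx' (lfD (bill bbeta _)).
  elim/(graded_ind HH): y => [y y' IHy IHy'|j y hy].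
    by rewrite (lmD le) (lfD (bilr bP _)) IHy IHy' (lfD (bilr bbeta _)).
  have [ij|ij] := eqVneq i j; last first.
    by rewrite (hP _ _ _ _ (hom_e hx) (hom_e hy) ij) (hbeta (hom_e hx) (hom_e hy) ij).
  have [i0|i0] := posnP i.
    rewrite i0 in hx; rewrite (hom0E HH hx) (lmZ le) e_1 scaler0.
    by rewrite (lf0 (bill bP _)) (lf0 (bill bbeta _)).
  rewrite (Phom i i) //; last exact: hom_e.
  by apply: (ph_e (gT i) (k := i)); rewrite ?i0 //= ij.
split=> //.
- by move=> x; split; [apply: (ph_1r (gT _)) | apply: (ph_1l (gT _))].
- move=> x y z; rewrite -/(convolution Delta (P x) (P y) z).
  elim/(graded_ind HH): z => [z z' IHz IHz'|k z hz].
    by rewrite (lfD (bilr bP _)) (lfD (lconv HH (bilr bP x) (bilr bP y))) IHz IHz'.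
  pose n := (N x + N y + N (x * y)%R + k)%N.
  have kn : (k <= n)%N by rewrite leq_addl.
  rewrite (PN n); last by rewrite /n addnAC leq_addl.
  rewrite (ph_ml (gT n) _ _ kn hz); apply: eq_conv => u; apply/esym/PN.
    by rewrite /n -!addnA leq_addr.
  by rewrite /n -!addnA addnCA leq_addr.
- move=> x y z; rewrite -/(convolution Delta (flip P y) (flip P z) x).
  have lPf := bilr (bilinear_flip bP).
  elim/(graded_ind HH): x => [x x' IHx IHx'|k x hx].
    by rewrite (lfD (bill bP _)) (lfD (lconv HH (lPf y) (lPf z))) IHx IHx'.
  (* The first arguments on the right are tensor factors of [Delta x], so the stage must also exceed
     their degrees. *)
  have [M MP] := pi_bound_seq HH (map fst (Delta x) ++ map snd (Delta x)).
  have kn : (k <= k + M)%N by rewrite leq_addr.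
  have MN u v : u \in map fst (Delta x) ++ map snd (Delta x) -> P u v = T (k + M)%N u v.
    move=> ux; apply: PE => k' lt; apply: MP => //.
    by apply: leq_trans (ltnW lt); apply: leq_addl.
  rewrite (Phom _ _ _ _ hx kn).
  have := ph_mr (gT (k + M)%N) y z kn hx; rewrite /flip => ->.
  apply: eq_big_seq => p xp; rewrite /flip !MN // mem_cat.
    by rewrite (map_f snd) ?orbT.
  by rewrite (map_f fst).
Qed.
End Pairing.

(** * The pairing attached to a form on primitive classes *)

Section PairingOfForm.
Variables (K : fieldType) (H : algType K) (pi : nat -> H -> H).
Variables (Delta : H -> seq (H * H)) (eps : H -> K).
Hypothesis HH : graded_connected_hopf pi Delta eps.
Variables (V : H -> Prop) (vp : H -> H) (lift : H -> seq (H * H)).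
Hypothesis FS : free_structure pi eps V vp lift.

Let lpi := lpi HH.
Let leps := leps HH.
Let lvp := vp_lin FS.
Local Notation conv := (convolution Delta).

(** Only [x] tensor [1] and [1] tensor [x] occur in the coproduct, and [eps] kills both factors of
    each product. *)
Lemma prim_orthogonal P x y : hopf_pairing pi Delta eps P ->
  prim Delta x -> Hplus2 pi y -> P x y = 0 /\ P y x = 0.
Proof.
case=> bP P1 Pl Pr _ px [s [sP ->]].
have lP := bilr bP; have rP := bill bP.
split; rewrite ?(lf_sum (lP x)) ?(lf_sum (rP x)) big_seq big1 // => p;
  case/sP=> /(HplusE HH) p1 /(HplusE HH) p2.
  rewrite Pr -/(conv (P^~ p.1) (P^~ p.2) x) (conv_prim (rP _) (rP _) px).
  by rewrite !(P1 _).2 p1 p2 mulr0 mul0r addr0.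
rewrite Pl -/(conv (P p.1) (P p.2) x) (conv_prim (lP _) (lP _) px).
by rewrite !(P1 _).1 p1 p2 mulr0 mul0r addr0.
Qed.

(** For a primitive [x] the difference [x - e x] is primitive and decomposable, hence invisible to
    both [P] and [B]. Symmetry goes by induction on the degree. *)
Lemma hopf_pairing_of_quot_form B : quot_form pi Delta B ->
  exists P, [/\ hopf_pairing pi Delta eps P,
    forall x y, prim Delta x -> prim Delta y -> P x y = B x y &
    (forall x y, prim Delta x -> prim Delta y -> B x y = B y x) ->
      forall x y, P x y = P y x].
Proof.
case=> bB B2 hB _.
have [rho [lrho prho rho_pi rho0 vp_rho]] := prim_section HH FS.
(* [vp] corrected so that its image contains the primitive elements [rho x]. *)
pose e x := vp x - vp (rho x) + rho x.
(* On the complement the form is [B] of the primitive representatives, so the kernel of [rho] pairs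
   to 0. *)
pose beta x y := B (rho x) (rho y).
have le : linear e.
  move=> a x y; rewrite /e lrho !lvp scalerDr scalerBr opprD.
  by rewrite [in RHS]addrACA; congr (_ + _); rewrite addrACA.
have e0 x : vp x = 0 -> e x = 0.
  by move=> v0; rewrite /e rho0 // v0 (lm0 lvp) subr0 addr0.
have vp_vp x : vp (vp x) = vp x by apply: (vp_id FS); apply: (vp_in FS).
have vp_e x : vp (e x) = vp x by rewrite /e (lmD lvp) (lmB lvp) !vp_vp subrK.
have vp_sub x : vp (x - e x) = 0 by rewrite (lmB lvp) vp_e subrr.
have e_idem x : e (e x) = e x.
  by apply/eqP; rewrite eq_sym -subr_eq0 -(lmB le) e0.
have rho_e x : rho (e x) = rho x.
  by apply/eqP; rewrite eq_sym -subr_eq0 -(lmB lrho) rho0.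
have e_pi n x : e (pi n x) = pi n (e x).
  by rewrite /e rho_pi !(vp_pi HH FS) (lmD (lpi n)) (lmB (lpi n)).
have bbeta : bilinear_form beta.
  move=> a x y z; rewrite /beta lrho.
  exact: (bB a _ _ _ (prho x) (prho y) (prho z)).
have hrho n x : hom pi n x -> hom pi n (rho x) by rewrite /hom -rho_pi => ->.
have hbeta : homogeneous_form pi beta.
  by move=> i j x y hx hy ij; apply: hB ij => //; apply: hrho.
have [|x y x0 y0|P [HP Pe]] :=
  hopf_pairing_exists HH FS le e_pi _ _ e_idem vp_e bbeta hbeta.
- by apply: e0; apply: (vp_1 FS).
- by apply: e0; apply: (vp_mul FS).
have PeE x y : P (e x) (e y) = B (rho x) (rho y) by rewrite Pe /beta !rho_e.
have [bP P1 Pl Pr hP] := HP.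
have lP := bilr bP; have rP := bill bP.
exists P; split=> // [x y px py|symB].
  have prim_e z : prim Delta z -> e z = rho z.
    by move=> pz; rewrite /e vp_rho // subrr add0r.
  have Hplus2_sub z : prim Delta z -> Hplus2 pi (z - e z).
    move=> pz; apply: (Hplus2P HH FS) => //; apply/(HplusE HH).
    by rewrite (lfB leps) prim_e // !(prim_eps HH) // subrr.
  have pe z : prim Delta z -> prim Delta (e z) by move=> pz; rewrite prim_e.
  have psub z : prim Delta z -> prim Delta (z - e z).
    by move=> pz; rewrite addrC -scaleN1r; apply: (prim_lin HH) => //; apply: pe.
  have -> : P x y = P (e x) (e y).
    rewrite -{1}[x](subrK (e x)) (lfD (rP _)) (prim_orthogonal HP py (Hplus2_sub x px)).2.
    rewrite add0r -{1}[y](subrK (e y)) (lfD (lP _)).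
    by rewrite (prim_orthogonal HP (pe x px) (Hplus2_sub y py)).1 add0r.
  rewrite PeE -!prim_e //; apply/esym.
  have -> : B x y = B (e x) y.
    have := (bB 1 _ _ _ (psub x px) (pe x px) py).1.
    rewrite scale1r subrK mul1r => ->.
    by rewrite (B2 _ _ (psub x px) py (Hplus2_sub x px)).1 add0r.
  have := (bB 1 _ _ _ (psub y py) (pe y py) (pe x px)).2.
  rewrite scale1r subrK mul1r => ->.
  by rewrite (B2 _ _ (psub y py) (pe x px) (Hplus2_sub y py)).2 add0r.
have sym_hom n x y : hom pi n x -> hom pi n y -> P x y = P y x.
  elim/ltn_ind: n x y => n IH x y hx hy.
  have [n0|n0] := posnP n.
    rewrite n0 in hx; rewrite (hom0E HH hx) (lfZ (rP y)) (lfZ (lP y)).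
    by rewrite (P1 y).1 (P1 y).2.
  (* If one argument is decomposable, the two product rules reduce symmetry to lower degrees; on the
     complement it is the symmetry of [B]. *)
  have sym_dec w z : hom pi n w -> vp w = 0 -> hom pi n z -> P w z = P z w.
    move=> hw vw hz; move: w hw n0 vw.
    apply: (decomposable_ind HH FS) => [|u v IHu IHv|k l u v k0 l0 kln hu hv].
    - by rewrite (lf0 (rP z)) (lf0 (lP z)).
    - by rewrite (lfD (rP z)) (lfD (lP z)) IHu IHv.
    have kn : (k < n)%N by rewrite -kln -[X in (X < _)%N]addn0 ltn_add2l.
    have ln : (l < n)%N by rewrite -kln -[X in (X < _)%N]add0n ltn_add2r.
    rewrite Pl Pr -/(conv (P u) (P v) z) -/(conv (P^~ u) (P^~ v) z).
    apply: (eq_conv_hom HH) hz _ => // i j a b ijn ha hb.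
    have [ik|ik] := eqVneq k i.
      have lj : l = j by apply/eqP; rewrite -(eqn_add2l k) kln ik ijn.
      congr (_ * _); [apply: (IH k kn) | apply: (IH l ln)] => //; first by rewrite ik.
      by rewrite lj.
    by rewrite (hP _ _ _ _ hu ha ik) (hP _ _ _ _ ha hu) ?mul0r // eq_sym.
  have he z : hom pi n z -> hom pi n (e z) by rewrite /hom -e_pi => ->.
  have hsub z : hom pi n z -> hom pi n (z - e z).
    by move=> hz; rewrite /hom (lmB (lpi n)) hz (he z hz).
  rewrite -[x](subrK (e x)) (lfD (rP y)) (lfD (lP y)) (sym_dec (x - e x) y) //; last exact: hsub.
  congr (_ + _).
  rewrite -[y](subrK (e y)) (lfD (rP (e x)) (y - e y)) (lfD (lP (e x)) (y - e y)).
  rewrite (sym_dec (y - e y) (e x)) //; first last.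
  - exact: he.
  - exact: hsub.
  by congr (_ + _); rewrite !PeE symB.
move=> x y; elim/(graded_ind HH): x => [x x' IHx IHx'|i x hx].
  by rewrite (lfD (rP y)) (lfD (lP y)) IHx IHx'.
elim/(graded_ind HH): y => [y y' IHy IHy'|j y hy].
  by rewrite (lfD (rP x)) (lfD (lP x)) IHy IHy'.
have [ij|ij] := eqVneq i j; first by apply: (sym_hom i) => //; rewrite ij.
by rewrite (hP _ _ _ _ hx hy ij) (hP _ _ _ _ hy hx) // eq_sym.
Qed.
End PairingOfForm.

(** * Cofreeness and non-degeneracy *)

Section Cofree.
Variables (K : fieldType) (H : algType K) (pi : nat -> H -> H).
Variables (Delta : H -> seq (H * H)) (eps : H -> K).
Hypothesis HH : graded_connected_hopf pi Delta eps.
Variables (W : lmodType K) (piW : nat -> W -> W) (phi : seq W -> H).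
Hypothesis gradedW : graded_space piW.
Hypothesis piW0 : forall w, piW 0 w = 0.
Hypothesis mphi : multilinear_words phi.
Hypothesis phi_hom : forall (w : seq W) (ds : seq nat), size ds = size w ->
  (forall i, (i < size w)%N -> piW (nth 0 ds i) (nth 0 w i) = nth 0 w i) ->
  hom pi (sumn ds) (phi w).
Hypothesis phi_gen : forall x, exists s : seq (K * seq W),
  x = \sum_(p <- s) p.1 *: phi p.2.
Hypothesis phi_inj : forall s : seq (K * seq W),
  \sum_(p <- s) p.1 *: phi p.2 = 0 -> tensor_words_zero s.
Hypothesis phi_Delta : forall w, teq2 (Delta (phi w))
  [seq (phi (take j w), phi (drop j w)) | j <- iota 0 (size w).+1].
Hypothesis phi_eps : forall w, eps (phi w) = if w is [::] then 1 else 0.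

Let lpi := lpi HH.
Let leps := leps HH.
Local Notation conv := (convolution Delta).

Lemma phi_nil : phi [::] = 1.
Proof.
have h0 : hom pi 0 (phi [::]) by apply: (phi_hom (ds := [::])).
by rewrite (hom0E HH h0) phi_eps scale1r.
Qed.

Lemma phi_letter_lin u v : linear (fun w => phi (u ++ w :: v)).
Proof. by move=> a x y; apply: mphi. Qed.

Lemma conv_phi f g w : lin_functional f -> lin_functional g ->
  conv f g (phi w) = \sum_(j < (size w).+1) f (phi (take j w)) * g (phi (drop j w)).
Proof.
move=> lf lg; rewrite /convolution phi_Delta // big_map.
rewrite -[RHS](big_mkord xpredT (fun j => f (phi (take j w)) * g (phi (drop j w)))).
by rewrite /index_iota subn0.
Qed.

Lemma piW_lin n : linear (piW n).
Proof. by case: gradedW => l _ _ a x y; apply: l. Qed.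

Lemma phi1_pi k w : pi k (phi [:: w]) = phi [:: piW k w].
Proof.
case: gradedW => lW pp /(_ w)[N wE].
have lphi := phi_letter_lin [::] [::].
rewrite wE (lm_sum (piW_lin k)) !(lm_sum lphi) (lm_sum (lpi k)) /=.
apply: eq_bigr => i _; rewrite pp.
have hi : hom pi i (phi [:: piW i w]).
  rewrite -[nat_of_ord i]addn0; apply: (phi_hom (ds := [:: nat_of_ord i])) => //.
  by case=> // _; rewrite /= addn0 pp eqxx.
case: eqP => [->|/eqP ne]; first exact: hi.
by rewrite (pi_hom HH hi ne) (lm0 lphi).
Qed.

(** As [W_0 = 0], every letter of [u] contributes at least 1 to the degree. The induction splits the
    first letter of [u] into components and moves it to [pre]. *)
Lemma phi_low_degree m u pre ds : size ds = size pre ->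
  (forall i, (i < size pre)%N -> piW (nth 0 ds i) (nth 0 pre i) = nth 0 pre i) ->
  (m < sumn ds + size u)%N -> pi m (phi (pre ++ u)) = 0.
Proof.
elim: u pre ds => [|x u IH] pre ds sds hds lt_m.
  rewrite cats0 (pi_hom HH (phi_hom sds hds)) // ltn_eqF //.
  by rewrite addn0 in lt_m.
case: gradedW => lW pp /(_ x)[N xE].
rewrite xE (lm_sum (phi_letter_lin pre u)) (lm_sum (lpi m)) big1 // => -[n ltn] _ /=.
case: n ltn => [|n] _; first by rewrite piW0 (lm0 (phi_letter_lin pre u)) (lm0 (lpi m)).
rewrite -cat_rcons; apply: (IH _ (rcons ds n.+1)).
- by rewrite !size_rcons sds.
- move=> i; rewrite size_rcons ltnS leq_eqVlt => /orP[/eqP ->|lt_i].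
    by rewrite -{1}sds !nth_rcons sds !ltnn !eqxx pp eqxx.
  by rewrite !nth_rcons sds lt_i hds.
rewrite sumn_rcons; apply: leq_trans lt_m _.
by rewrite /= addnS -addnA ltn_add2l addSn ltnS leq_addl.
Qed.

(** Functionals [F k f] read off the component of word length [k]. At a primitive element they
    vanish for [k = 0] by the counit, and for [k >= 2] by deconcatenation. *)
Lemma prim_phi x : prim Delta x -> exists w, x = phi [:: w].
Proof.
move=> px; have [r rP] := choice phi_gen.
pose word_val k (f : nat -> W -> K) (w : seq W) :=
  if size w == k then \prod_(i < k) f i (nth 0 w i) else 0.
pose F k f y := \sum_(p <- r y) p.1 * word_val k f p.2.
have F_eval k f s : (forall i, lin_functional (f i)) ->
    F k f (\sum_(p <- s) p.1 *: phi p.2) = \sum_(p <- s) p.1 * word_val k f p.2.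
  move=> lf; set y := \sum_(p <- s) _; apply/eqP; rewrite -subr_eq0; apply/eqP.
  have tz : tensor_words_zero (r y ++ [seq (- p.1, p.2) | p <- s]).
    apply: phi_inj; rewrite big_cat big_map /= -rP.
    by under eq_bigr do rewrite scaleNr; rewrite sumrN subrr.
  have := tz k f lf; rewrite big_cat big_map /= /F -sumrN => e0; rewrite -[RHS]e0.
  congr (_ + _); rewrite [RHS]big_mkcond; apply: eq_bigr => p _; rewrite /word_val.
    by case: eqP; rewrite ?mulr0.
  by case: eqP; rewrite ?mulr0 ?oppr0 ?mulNr.
have F_lin k f : (forall i, lin_functional (f i)) -> lin_functional (F k f).
  move=> lf a y z.
  have -> : a *: y + z =
      \sum_(p <- [seq (a * p.1, p.2) | p <- r y] ++ r z) p.1 *: phi p.2.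
    rewrite big_cat big_map /= -rP {1}(rP y) scaler_sumr; congr (_ + _).
    by apply: eq_bigr => p _; rewrite scalerA.
  rewrite F_eval // big_cat big_map /= /F mulr_sumr; congr (_ + _).
  by apply: eq_bigr => p _; rewrite mulrA.
have F_phi k f w : (forall i, lin_functional (f i)) -> F k f (phi w) = word_val k f w.
  move=> lf; have := F_eval k f [:: (1, w)] lf.
  by rewrite !big_seq1 scale1r mul1r.
have phi_ext g h : lin_functional g -> lin_functional h ->
    (forall w, g (phi w) = h (phi w)) -> g =1 h.
  move=> lg lh gh y; rewrite (rP y) !lf_sum //; apply: eq_bigr => p _.
  by rewrite !lfZ // gh.
have F0 f : (forall i, lin_functional (f i)) -> F 0%N f x = 0.
  move=> lf; rewrite -(prim_eps HH px); apply: phi_ext => [||w] //; first exact: F_lin.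
  by rewrite F_phi // phi_eps /word_val; case: w => //; rewrite big_ord0.
have F2 k f : (forall i, lin_functional (f i)) -> F k.+2 f x = 0.
  move=> lf; pose f' i := f i.+1.
  have lf' i : lin_functional (f' i) by apply: lf.
  have lF1 := F_lin 1%N f lf; have lFk := F_lin k.+1 f' lf'.
  (* A word of length [k.+2] is cut after its first letter. Both factors vanish at [1], the empty
     word, so the convolution vanishes at a primitive element. *)
  have -> : F k.+2 f x = conv (F 1%N f) (F k.+1 f') x.
    apply: phi_ext => [||w]; [exact: F_lin|exact: (lconv HH)|].
    rewrite conv_phi // F_phi //; case: w => [|w0 w].
      by rewrite big_ord1 /= !F_phi // mul0r.
    rewrite big_ord_recl [in X in _ + X]big_ord_recl /= take0 drop0.
    rewrite !F_phi // {2}/word_val mul0r add0r big1 => [|j _].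
      rewrite addr0 /word_val /= big_ord1 /= eqSS; case: eqP => [e|]; last by rewrite mulr0.
      by rewrite big_ord_recl.
    rewrite !F_phi // {1}/word_val /= size_takel /bump //= ?add0n ?add1n ?mul0r //.
  rewrite (conv_prim lF1 lFk px) -phi_nil !F_phi // /word_val /=.
  by rewrite mulr0 mul0r addr0.
pose s := r x; pose s' := [seq p <- s | size p.2 != 1%N].
have s'0 : \sum_(p <- s') p.1 *: phi p.2 = 0.
  apply: (functionals_separate HH) => l ll; rewrite (lf_sum ll).
  under eq_bigr do rewrite (lfZ ll).
  apply: (tensor_words_zero_multilinear (M := fun w => l (phi w))).
    by move=> u v a w w'; rewrite mphi ll.
  move=> k f lf; rewrite big_filter_cond.
  have [->|k1] := eqVneq k 1%N.
    by rewrite big_pred0 // => p; rewrite andNb.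
  transitivity (F k f x).
    rewrite big_mkcond; apply: eq_bigr => p _; rewrite /word_val.
    have [->|_] := eqVneq (size p.2) k; first by rewrite k1.
    by rewrite andbF mulr0.
  by case: k k1 => [|[|k]] // _; [apply: F0 | apply: F2].
exists (\sum_(p <- s | size p.2 == 1%N) p.1 *: head 0 p.2).
rewrite (lm_sum (phi_letter_lin [::] [::])) (rP x) -/s.
rewrite (bigID (fun p => size p.2 == 1%N)) /= -[X in _ + X]big_filter s'0 addr0.
apply: eq_bigr => p /eqP sp; rewrite (lmZ (phi_letter_lin [::] [::])) /=.
by case: p.2 sp => // w [].
Qed.

Lemma prim_phi_hom k x : prim Delta x -> hom pi k x ->
  exists2 w, piW k w = w & x = phi [:: w].
Proof.
move=> /prim_phi[w xE] hx; exists (piW k w); last by rewrite -phi1_pi -xE.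
by case: gradedW => _ -> _; rewrite eqxx.
Qed.

(** * Orthogonality and non-degeneracy *)

Variables (V : H -> Prop) (vp : H -> H) (lift : H -> seq (H * H)).
Hypothesis FS : free_structure pi eps V vp lift.
Variable P : H -> H -> K.
Hypothesis HP : hopf_pairing pi Delta eps P.

Let bP : bilinear_form P. Proof. by case: HP. Qed.
Let hP : homogeneous_form pi P. Proof. by case: HP. Qed.
Let lP := bilr bP.
Let rP := bill bP.

Let P_mull x y z : P (x * y) z = conv (P x) (P y) z.
Proof. by case: HP. Qed.

Let P_mulr x y z : P x (y * z) = conv (P^~ y) (P^~ z) x.
Proof. by case: HP. Qed.

Lemma pairing_pir n x y : hom pi n x -> P x y = P x (pi n y).
Proof.
move=> hx; elim/(graded_ind HH): y => [y z IHy IHz|m y hy].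
  by rewrite (lmD (lpi n)) !(lfD (lP x)) IHy IHz.
have [<-|ne] := eqVneq m n; first by rewrite hy.
by rewrite (pi_hom HH hy) 1?eq_sym // (lf0 (lP x)) (hP hx hy) // eq_sym.
Qed.

(** One side suffices, since the components are finite-dimensional. *)
Definition left_nondeg n := forall x, hom pi n x ->
  (forall y, hom pi n y -> P x y = 0) -> x = 0.

(** In coordinates the Gram matrix [M] of the degree [n] component is invertible, so functionals are
    represented on either side. *)
Lemma left_nondeg_represent n f : left_nondeg n -> lin_functional f ->
  (exists2 z, hom pi n z & forall x, hom pi n x -> f x = P x z) /\
  (exists2 z, hom pi n z & forall x, hom pi n x -> f x = P z x).
Proof.
move=> nd lf; have [d [c [t [lc lt ht ct tc]]]] := hom_coordinates HH n.
pose b i := t (delta_mx 0 i).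
have tE u : t u = \sum_i u 0 i *: b i.
  rewrite {1}[u]row_sum_delta (lm_sum lt); apply: eq_bigr => i _.
  by rewrite (lmZ lt).
pose M := \matrix_(i, j) P (b i) (b j).
pose F := \col_i f (b i).
have fE u : f (t u) = (u *m F) 0 0.
  rewrite tE (lf_sum lf) !mxE; apply: eq_bigr => i _.
  by rewrite (lfZ lf) !mxE.
have PE u v : P (t u) (t v) = (u *m M *m v^T) 0 0.
  rewrite !tE (lf_sum (rP _)) -mulmxA !mxE; apply: eq_bigr => i _.
  rewrite (lfZ (rP _)) (lf_sum (lP _)) !mxE; congr (_ * _); apply: eq_bigr => j _.
  by rewrite (lfZ (lP _)) !mxE mulrC.
(* A row in the left kernel of [M] gives an element orthogonal to the whole component. *)
have uM : M \in unitmx.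
  rewrite -row_free_unit -kermx_eq0; apply/eqP/row_matrixP => i; rewrite row0.
  have k0 : row i (kermx M) *m M = 0 by apply/sub_kermxP; apply: row_sub.
  rewrite -[LHS]ct (nd (t (row i (kermx M)))) ?(lm0 lc) // => y hy.
  by rewrite -hy -tc PE k0 mul0mx mxE.
split.
  exists (t (invmx M *m F)^T) => // x hx.
  by rewrite -hx -tc PE fE trmxK -mulmxA mulKVmx.
exists (t (F^T *m invmx M)) => // x hx.
by rewrite -hx -tc PE fE mulmxKV // -trmx_mul [RHS]mxE.
Qed.

(** Below degree [n] functionals are represented by elements [a] and [b], so a mixed component of
    [Delta x] is tested by [P x (a * b)]. *)
Lemma prim_of_orthogonal_r n x : (forall k, (k < n)%N -> left_nondeg k) ->
  hom pi n x -> (0 < n)%N ->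
  (forall i j a b, (0 < i)%N -> (0 < j)%N -> (i + j)%N = n ->
     hom pi i a -> hom pi j b -> P x (a * b) = 0) -> prim Delta x.
Proof.
move=> nd hx n0 x0; apply: (prim_criterion HH hx n0) => f g i j lf lg i0 j0 ijn.
have i_n : (i < n)%N by rewrite -ijn -[X in (X < _)%N]addn0 ltn_add2l.
have j_n : (j < n)%N by rewrite -ijn -[X in (X < _)%N]add0n ltn_add2r.
have [[a ha fE] _] := left_nondeg_represent (nd i i_n) (lf_pi HH i lf).
have [[b hb gE] _] := left_nondeg_represent (nd j j_n) (lf_pi HH j lg).
rewrite -(x0 i j a b) // P_mulr; apply: (eq_conv_hom HH) hx _ => //; try exact: (lf_pi HH).
move=> i' j' c d ijn' hc hd.
have [ii|ii] := eqVneq i' i.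
  have jj : j' = j by apply/eqP; rewrite -(eqn_add2l i) ijn -ii ijn'.
  by rewrite ii in hc; rewrite jj in hd; rewrite fE // gE.
by rewrite (hP hc ha ii) (pi_hom HH hc) 1?eq_sym // (lf0 lf) !mul0r.
Qed.

Lemma prim_of_orthogonal_l n x : (forall k, (k < n)%N -> left_nondeg k) ->
  hom pi n x -> (0 < n)%N ->
  (forall i j a b, (0 < i)%N -> (0 < j)%N -> (i + j)%N = n ->
     hom pi i a -> hom pi j b -> P (a * b) x = 0) -> prim Delta x.
Proof.
move=> nd hx n0 x0; apply: (prim_criterion HH hx n0) => f g i j lf lg i0 j0 ijn.
have i_n : (i < n)%N by rewrite -ijn -[X in (X < _)%N]addn0 ltn_add2l.
have j_n : (j < n)%N by rewrite -ijn -[X in (X < _)%N]add0n ltn_add2r.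
have [_ [a ha fE]] := left_nondeg_represent (nd i i_n) (lf_pi HH i lf).
have [_ [b hb gE]] := left_nondeg_represent (nd j j_n) (lf_pi HH j lg).
rewrite -(x0 i j a b) // P_mull; apply: (eq_conv_hom HH) hx _ => //; try exact: (lf_pi HH).
move=> i' j' c d ijn' hc hd.
have [ii|ii] := eqVneq i' i.
  have jj : j' = j by apply/eqP; rewrite -(eqn_add2l i) ijn -ii ijn'.
  by rewrite ii in hc; rewrite jj in hd; rewrite fE // gE.
by rewrite (hP ha hc) 1?eq_sym // (pi_hom HH hc) 1?eq_sym // (lf0 lf) !mul0r.
Qed.

(** For a functional [l], the element [z] representing [l] composed with [vp] is orthogonal to
    products, hence primitive, hence a letter; so [l u = P u z = 0]. *)
Lemma generator_orthogonal_letters k u : (forall j, (j <= k)%N -> left_nondeg j) ->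
  (0 < k)%N -> V u -> hom pi k u ->
  (forall w, piW k w = w -> P u (phi [:: w]) = 0) -> u = 0.
Proof.
move=> nd k0 Vu hu uW; apply: (functionals_separate HH) => l ll.
have [[z hz zE] _] := left_nondeg_represent (nd k (leqnn k)) (lf_comp (vp_lin FS) ll).
have pz : prim Delta z.
  apply: (prim_of_orthogonal_l _ hz k0) => [j jk|i j a b i0 j0 ijk ha hb].
    exact/nd/ltnW.
  rewrite -zE; last by rewrite -ijk; apply: (homM HH).
  by rewrite (vp_mul FS) ?(lf0 ll) //; [apply: (Hplus_hom HH ha) | apply: (Hplus_hom HH hb)].
have [w hw zw] := prim_phi_hom pz hz.
by rewrite -(vp_id FS Vu) zE // zw uW.
Qed.

(* [\sum_q q.1 *: phi (w :: q.2)] plays the role of the concatenation of [w] with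
   [\sum_q q.1 *: phi q.2]; the prefixes longer than [[:: w]] have degree above [k]
   and pair to [0] with [v]. *)
Lemma conv_concat j k v b w (s : seq (K * seq W)) : (0 < j <= k)%N -> hom pi j v ->
  piW k w = w ->
  conv (P v) (P b) (\sum_(q <- s) q.1 *: phi (w :: q.2)) =
    P v (phi [:: w]) * P b (\sum_(q <- s) q.1 *: phi q.2).
Proof.
move=> /andP[j0 jk] hv hw; have lc := lconv HH (lP v) (lP b).
rewrite (lf_sum lc) (lf_sum (lP b)) mulr_sumr; apply: eq_bigr => -[c u] _ /=.
rewrite (lfZ lc) (lfZ (lP b)) mulrCA; congr (_ * _); rewrite conv_phi //.
rewrite big_ord_recl [in X in _ + X]big_ord_recl /= take0 drop0 phi_nil.
have -> : P v 1 = 0 by case: HP => _ P1 _ _ _; rewrite (P1 v).1 (eps_hom HH hv).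
rewrite mul0r add0r big1 ?addr0 // => i _.
rewrite (pairing_pir _ hv) (phi_low_degree (pre := [:: w]) (ds := [:: k])) //.
- by rewrite (lf0 (lP v)) mul0r.
- by case=> // _ /=.
rewrite /= addn0 size_takel; last exact: ltn_ord.
by rewrite /bump /= !add0n add1n addnS ltnS (leq_trans jk) // leq_addr.
Qed.

Lemma left_nondeg_all B n : quot_form pi Delta B ->
  (forall x y, prim Delta x -> prim Delta y -> P x y = B x y) -> left_nondeg n.
Proof.
move=> [_ _ _ [ndB _]] PB; elim/ltn_ind: n => n IH x hx x0'.
have x0 y : P x y = 0 by rewrite (pairing_pir _ hx); apply: x0'; apply: (hom_pi HH).
have [n0|n0] := posnP n.
  rewrite n0 in hx; rewrite (hom0E HH hx); have [_ P1 _ _ _] := HP.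
  by rewrite -(P1 x).1 x0 scale0r.
have px : prim Delta x by apply: (prim_of_orthogonal_r IH hx n0) => *; apply: x0.
have vx : vp x = 0.
  by apply: (vp_Hplus2 FS); apply: ndB => // y py; rewrite -PB.
(* [s k] is the part of [lift x] in bidegree [(k, n - k)]. *)
pose s k := [seq (pi k p.1, pi (n - k)%N p.2) | p <- lift x].
have xE : x = \sum_(k < n.+1) \sum_(p <- s k) p.1 * p.2.
  rewrite -{1}hx {1}(Hplus2_lift HH FS (Hplus_hom HH hx n0) vx) (lm_sum (lpi n)).
  under [RHS]eq_bigr do rewrite big_map /=.
  by rewrite exchange_big /=; apply: eq_bigr => p _; rewrite (piM HH).
have s0 : teq2 (s 0%N) [::].
  move=> f g lf lg; rewrite big_map big_nil big_seq big1 //= => p.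
  by case/(lift_in FS)=> /(fs_plus FS) -> _; rewrite (lf0 lf) mul0r.
have sn : teq2 (s n) [::].
  move=> f g lf lg; rewrite big_map big_nil big_seq big1 //= => p.
  by case/(lift_in FS)=> _; rewrite subnn => ->; rewrite (lf0 lg) mulr0.
have sV k p : p \in s k -> V p.1 /\ hom pi k p.1 /\ hom pi (n - k)%N p.2.
  case/mapP=> q /(lift_in FS)[Vq _] ->; split; first exact: (fs_pi FS).
  by split; apply: (hom_pi HH).
(* Descending induction on [k], with [d] bounding [n - k]; it starts at [k = n]. *)
suff all0 d k : (k <= n)%N -> (n - k <= d)%N -> teq2 (s k) [::].
  rewrite xE big1 // => k _; apply: (teq2_null_mul HH).
  by apply: (all0 n); rewrite ?leq_subr // -ltnS.
elim: d k => [|d IHd] k kn nkd.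
  suff -> : k = n by [].
  by apply/eqP; rewrite eqn_leq kn -subn_eq0 -leqn0.
have [->//|k_n] := eqVneq k n.
have [->//|k0] := posnP k.
have {}kn : (k < n)%N by rewrite ltn_neqAle k_n.
(* Pairing [x] with the concatenation [z] of [w] and [y] leaves only the part [s k]. *)
have letter_sum w y : piW k w = w -> \sum_(p <- s k) P p.1 (phi [:: w]) * P p.2 y = 0.
  move=> hw; have [r yE] := phi_gen y; pose z := \sum_(q <- r) q.1 *: phi (w :: q.2).
  have hphi : hom pi k (phi [:: w]) by rewrite /hom phi1_pi hw.
  transitivity (P x z); last exact: x0.
  rewrite {1}xE (lf_sum (rP z)) (bigD1 (Ordinal (ltnW kn : (k < n.+1)%N))) //=.
  rewrite [X in _ = _ + X]big1 ?addr0 => [|j jk].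
    rewrite (lf_sum (rP z)) big_seq [RHS]big_seq; apply: eq_bigr => p /sV[_ [hp _]].
    by rewrite P_mull (conv_concat _ _ _ hp hw) ?k0 ?leqnn // -yE.
  rewrite (lf_sum (rP z)); under eq_bigr do rewrite P_mull.
  (* Parts with [j > k] vanish by the induction hypothesis, [j = 0] because generators lie in [H^+],
     and the other [j < k] because degrees [j] and [k] are orthogonal. *)
  have [kj|jk'] := ltnP k j.
    rewrite exchange_big /= big1 // => q _.
    have := IHd j; rewrite -ltnS ltn_ord => /(_ isT).
    move=> /(_ _ (P^~ q.1) (P^~ q.2) (rP _) (rP _)); rewrite big_nil; apply.
    by rewrite -ltnS; apply: leq_trans nkd; apply: ltn_sub2l.
  have [j0|j0] := posnP j.
    rewrite j0 big_map /= big_seq big1 // => p /(lift_in FS)[/(fs_plus FS) -> _].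
    by rewrite /convolution big1 // => q _; rewrite (lf0 (rP _)) mul0r.
  rewrite big_seq big1 // => p /sV[_ [hp _]].
  by rewrite (conv_concat _ _ _ hp hw) ?j0 //= (hP hp hphi) ?mul0r.
(* As [k > 0], the second factors have degree below [n], where the pairing is already
   non-degenerate. *)
have letter_comb w : piW k w = w ->
    \sum_(p <- s k) P p.1 (phi [:: w]) *: p.2 = 0.
  move=> hw; apply: (IH (n - k)%N).
  - by rewrite -subn_gt0 subKn // ltnW.
  - rewrite big_seq; apply: (hom_sum HH) => p /sV[_ [_ hp]]; exact: (homZ HH).
  move=> y _; rewrite (lf_sum (rP y)) -[RHS](letter_sum w y hw); apply: eq_bigr => p _.
  by rewrite (lfZ (rP y)).
move=> f g lf lg; rewrite big_nil.
(* Applying [g] to the second factors gives a combination of generators orthogonal to all letters of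
   degree [k]. *)
have u0 : \sum_(p <- s k) g p.2 *: p.1 = 0.
  apply: (@generator_orthogonal_letters k) => // [j jk|||w hw].
  - by apply: IH; apply: leq_ltn_trans kn.
  - rewrite big_seq; apply: (big_rec V) => [|p y /sV[Vp _] Vy].
      by rewrite -(lm0 (vp_lin FS)); apply: (vp_in FS).
    exact: (fs_lin FS).
  - rewrite big_seq; apply: (hom_sum HH) => p /sV[_ [hp _]]; exact: (homZ HH).
  transitivity (g (\sum_(p <- s k) P p.1 (phi [:: w]) *: p.2)); last first.
    by rewrite letter_comb // (lf0 lg).
  rewrite (lf_sum (rP _)) (lf_sum lg).
  by apply: eq_bigr => p _; rewrite (lfZ (rP _)) (lfZ lg) mulrC.
transitivity (f (\sum_(p <- s k) g p.2 *: p.1)); last by rewrite u0 (lf0 lf).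
rewrite (lf_sum lf); apply: eq_bigr => p _.
by rewrite (lfZ lf) mulrC.
Qed.

Lemma nondegenerate B : quot_form pi Delta B ->
  (forall x y, prim Delta x -> prim Delta y -> P x y = B x y) -> nondeg_pairing P.
Proof.
move=> qB PB; have nd n := left_nondeg_all (n := n) qB PB.
split=> [x x0|y y0]; apply: (pi_ext HH) => n; rewrite (lm0 (lpi n)).
  apply: (nd n); first exact: (hom_pi HH).
  move=> y hy; rewrite -[RHS](x0 y).
  elim/(graded_ind HH): x {x0} => [x x' IHx IHx'|m x hx].
    by rewrite (lmD (lpi n)) !(lfD (rP y)) IHx IHx'.
  have [<-|ne] := eqVneq m n; first by rewrite hx.
  by rewrite (pi_hom HH hx) 1?eq_sym // (lf0 (rP y)) (hP hx hy).
(* On the right: every functional on degree [n] is [P z] for some [z], hence kills the component of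
   [y]. *)
apply: (functionals_separate HH) => f lf.
have [_ [z hz ->]] := left_nondeg_represent (nd n) lf; last exact: (hom_pi HH).
by rewrite -(pairing_pir _ hz).
Qed.
End Cofree.

Theorem theorem5 (K : fieldType) (H : algType K) (pi : nat -> H -> H)
    (Delta : H -> seq (H * H)) (eps : H -> K) :
  (2%:R : K) != 0 ->
  graded_connected_hopf pi Delta eps ->
  is_free pi -> is_cofree pi Delta eps ->
  forall B : H -> H -> K, quot_form pi Delta B ->
    (exists P : H -> H -> K,
        [/\ hopf_pairing pi Delta eps P, nondeg_pairing P &
            forall x y, prim Delta x -> prim Delta y -> P x y = B x y]) /\
    ((forall x y, prim Delta x -> prim Delta y -> B x y = B y x) ->
     exists P : H -> H -> K,
        [/\ hopf_pairing pi Delta eps P, nondeg_pairing P,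
            forall x y, prim Delta x -> prim Delta y -> P x y = B x y &
            forall x y, P x y = P y x]).
Proof.
move=> _ HH /(free_structure_exists HH)[V [vp [lift FS]]].
move=> [W [piW [phi [[gW W0] mphi hphi [genphi injphi] [Dphi ephi]]]]] B qB.
(* One pairing serves both claims: it is symmetric as soon as [B] is. *)
have [P [HP PB symP]] := hopf_pairing_of_quot_form HH FS qB.
have nd := nondegenerate HH gW W0 mphi hphi genphi injphi Dphi ephi FS HP qB PB.
split; first by exists P.
by move=> symB; exists P; split=> //; apply: symP.
Qed.
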